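(* Let $G$ be a finitely generated metabelian group which is the extension of an abelian group by a finitely generated abelian group $Q$ (that is, there is a short exact sequence $M\hookrightarrow G\twoheadrightarrow Q$ with $M$ abelian). Then $G$ can be embedded in a finitely generated split metabelian group $B\rtimes Q$, with $B$ abelian, such that $B\rtimes Q$ has the same Krull dimension as $G$.
   Context: A group is metabelian if its derived subgroup is abelian. Krull dimension of a group. A poset $A$ is trivial if $a\le b$ implies $a=b$. The deviation $\operatorname{dev} A$, if it exists, is: $-\infty$ if $A$ is empty or trivial; $0$ if $A$ is non-trivial and satisfies the descending chain condition; and inductively $\operatorname{dev} A = n$ (an ordinal) if $\operatorname{dev} A$ is not equal to $m$ for any $m<n$ and in every descending chain $a_1\ge a_2\ge\dots$ of $A$ all but finitely many of the factors $[a_{i+1},a_i]=\{x : a_{i+1}\le x\le a_i\}$ have deviation defined and less than $n$. The Krull dimension $\operatorname{Krull}(G)$ of a group $G$ is the deviation of the poset of normal subgroups of $G$, ordered by inclusion. (It exists for finitely generated metabelian groups.) *)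

(* Defs.v *)
From HB Require Import structures.
From mathcomp Require Import all_boot all_order.
From mathcomp Require Import boolp classical_sets.

Set Implicit Arguments.
Unset Strict Implicit.
Unset Printing Implicit Defensive.

Local Open Scope classical_set_scope.
Local Open Scope group_scope.

Section Subgroups.
Context {G : groupType}.
Implicit Types H N S : set G.

Definition is_subgroup H : Prop :=
  H 1 /\ forall x y, H x -> H y -> H (x / y).

Definition is_normal_subgroup N : Prop :=
  is_subgroup N /\ forall x g, N x -> N (x ^ g).

Definition generated S : set G := smallest is_subgroup S.

Definition derived_subgroup : set G :=
  generated [set [~ x.1, x.2] | x in [set: G * G]].

Definition is_abelian H : Prop :=
  forall x y, H x -> H y -> commute x y.

End Subgroups.

Definition abelian_group (G : groupType) : Prop := is_abelian [set: G].

Definition metabelian (G : groupType) : Prop :=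
  is_abelian (@derived_subgroup G).

Definition finitely_generated (G : groupType) : Prop :=
  exists s : seq G, generated [set` s] = [set: G].

Definition short_exact (M G Q : groupType)
    (i : {multiplicative M -> G}) (p : {multiplicative G -> Q}) : Prop :=
  [/\ injective i, range i = [set g | p g = 1] & range p = [set: Q]].

Record automorphic_action (Q B : groupType) := AutomorphicAction {
  act_by :> Q -> B -> B;
  act_by1 : forall b, act_by 1 b = b;
  act_byM : forall q r b, act_by (q * r) b = act_by q (act_by r b);
  act_byMr : forall q b c, act_by q (b * c) = act_by q b * act_by q c }.

(* A fresh record rather than B * Q, which already carries the direct product
   group structure. *)
Record semidirect (Q B : groupType) (a : automorphic_action Q B) :=
  Semidirect { sd_normal : B; sd_compl : Q }.

Section Semidirect.
Variables (Q B : groupType) (a : automorphic_action Q B).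
Notation E := (semidirect a).

Definition pair_of_sd (x : E) : B * Q := (sd_normal x, sd_compl x).
Definition sd_of_pair (x : B * Q) : E := Semidirect a x.1 x.2.

Lemma pair_of_sdK : cancel pair_of_sd sd_of_pair.
Proof. by case. Qed.

HB.instance Definition _ := Choice.copy E (can_type pair_of_sdK).

Definition sd_one : E := Semidirect a 1 1.
Definition sd_mul (x y : E) : E :=
  Semidirect a (sd_normal x * a (sd_compl x) (sd_normal y))
               (sd_compl x * sd_compl y).
Definition sd_inv (x : E) : E :=
  Semidirect a (a (sd_compl x)^-1 (sd_normal x)^-1) (sd_compl x)^-1.

Lemma act_by_one q : a q 1 = 1.
Proof. by apply: (mulgI (a q 1)); rewrite -act_byMr !mulg1. Qed.

Lemma sd_mulA : associative sd_mul.
Proof.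
by move=> [b q] [c r] [d s]; rewrite /sd_mul /= act_byMr act_byM !mulgA.
Qed.

Lemma sd_mul1g : left_id sd_one sd_mul.
Proof. by move=> [b q]; rewrite /sd_mul /= act_by1 !mul1g. Qed.

Lemma sd_mulg1 : right_id sd_one sd_mul.
Proof. by move=> [b q]; rewrite /sd_mul /= act_by_one !mulg1. Qed.

Lemma sd_mulVg : left_inverse sd_one sd_inv sd_mul.
Proof.
by move=> [b q]; rewrite /sd_mul /sd_inv /= -act_byMr !mulVg act_by_one.
Qed.

Lemma sd_mulgV : right_inverse sd_one sd_inv sd_mul.
Proof.
by move=> [b q]; rewrite /sd_mul /sd_inv /= -act_byM !mulgV act_by1 mulgV.
Qed.

HB.instance Definition _ :=
  isGroup.Build E sd_mulA sd_mul1g sd_mulg1 sd_mulVg sd_mulgV.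

End Semidirect.

Record wellOrder := WellOrder {
  wo_display : Order.disp_t;
  wo_sort :> orderType wo_display;
  wo_wf : well_founded (fun m n : wo_sort => (m < n)%O) }.

(* An element n of a well-order W stands for the ordinal that is the order type
   of {m : W | m < n}; every ordinal arises in this way.  In a value
   delta : option W of the deviation, None stands for -oo. *)
Section Deviation.
Context (W : wellOrder) {d : Order.disp_t} {T : porderType d}.
Implicit Types A : set T.

Definition trivial_poset A : Prop :=
  forall a b, A a -> A b -> (a <= b)%O -> a = b.

Definition descending_chain A (a : nat -> T) : Prop :=
  (forall i, A (a i)) /\ forall i, (a i.+1 <= a i)%O.

Definition poset_factor A (b a : T) : set T :=
  [set x | A x /\ (b <= x <= a)%O].

Definition DCC A : Prop :=
  forall a, descending_chain A a ->
    exists k, forall i, (k <= i)%N -> a i.+1 = a i.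

(* In deviation_step n rec, rec m is the predicate [dev _ = m], for m < n. *)
Definition deviation_step (n : W)
    (rec : forall m : W, (m < n)%O -> set T -> Prop) (A : set T) : Prop :=
  let dev_lt_n F := trivial_poset F \/ exists m (mn : (m < n)%O), rec m mn F in
  ((forall m, (n <= m)%O) /\ ~ trivial_poset A /\ DCC A)
  \/ ((exists m, (m < n)%O) /\ ~ dev_lt_n A /\
      forall a, descending_chain A a ->
        exists k, forall i, (k <= i)%N ->
          dev_lt_n (poset_factor A (a i.+1) (a i))).

Definition has_deviation A (delta : option W) : Prop :=
  match delta with
  | None => trivial_poset A
  | Some n => Fix (@wo_wf W) (fun=> set T -> Prop) deviation_step n A
  end.

End Deviation.

Definition has_Krull_dimension (W : wellOrder) (G : groupType)
    (delta : option W) : Prop :=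
  has_deviation [set N : set G | is_normal_subgroup N] delta.

(* Main.v *)
Require Import Defs.
From HB Require Import structures.
From mathcomp Require Import all_boot all_order.
From mathcomp Require Import boolp classical_sets.

(** Let [M] also denote its image in [G]; conjugation makes it a [Q]-module.

The embedding.  Choosing a set-theoretic section of [p] gives a cocycle
[delta] from [G] to the coinduced module of functions [Q -> M], injective on
[M], and [g |-> (delta g, p g)] embeds [G] in a split extension
([coinduced_cocycle]).  The [Q]-submodule [P] generated by the values of
[delta] on generators of [G] contains every value of [delta], hence a copy of
[M], but [P / M] may have a larger Krull dimension than [M].  So [P] is
replaced by [B = P / K], where [K] is maximal among the submodules of [P] that
meet [M] trivially: [M] still embeds in [B], and now every nontrivial submodule
of [B] meets [M] ([essential_cocycle]).  The maximal [K] exists because [P] is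
Noetherian, by Hilbert's basis theorem for finitely generated abelian groups of
operators ([ACC_fg_module]).

The dimension.  An essential extension [B] of [M] has the same deviation of
submodules as [M] ([dev_essential]).  A scalar [r] that kills [M] is nilpotent
on [B]: for large [n] the image of [r ^ n] meets its kernel trivially, hence
meets [M] trivially, hence is trivial.  Filtering by the images of the powers
of [r] bounds the deviation of [B] by that of [B / r B]; by Noetherian
induction only quotients of [B] killed by the annihilator of [M] remain.  Such
a quotient is an iterated extension of cyclic modules, and the ideals
annihilating larger and larger submodules of [M] filter a cyclic module so that
each layer is controlled by the submodules of [M].

Finally a normal subgroup of the split extension is determined, among those
above it, by its intersection with [B] and its image in [Q]; likewise in [G],
with [M] for [B].  So both Krull dimensions are the larger of the deviations of
the submodules of [M] and of the subgroups of [Q] ([same_Krull_dimension]).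

All comparisons of deviations go through one principle, [dev_at_most_pair]: a
bound on the deviation passes to a poset from two posets to which it maps
monotonically so that the pair of maps is strict on comparable elements.  The
deviation exists because normal subgroups of the split extension satisfy the
ascending chain condition, which yields a rank with values in a well-order
([ACC_dev_le]). *)

Set Implicit Arguments.
Unset Strict Implicit.
Unset Printing Implicit Defensive.

Import Order.TTheory.
Local Open Scope classical_set_scope.
Local Open Scope group_scope.

(** * Upper bounds for the deviation *)

(** The standard example is a modular lattice with [f1] and [f2] the meet and the
    join with a fixed element. *)
Definition strict_pair {d d1 d2} {T : porderType d} {T1 : porderType d1}
    {T2 : porderType d2} (A : set T) (A1 : set T1) (A2 : set T2)
    (f1 : T -> T1) (f2 : T -> T2) : Prop :=
  [/\ forall x, A x -> A1 (f1 x),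
      forall x, A x -> A2 (f2 x),
      forall x y, A x -> A y -> (x <= y)%O -> (f1 x <= f1 y)%O,
      forall x y, A x -> A y -> (x <= y)%O -> (f2 x <= f2 y)%O &
      forall x y, A x -> A y -> (x <= y)%O -> f1 x = f1 y -> f2 x = f2 y ->
        x = y].

Section DeviationBound.
Context (W : wellOrder).

(** The chain condition of the deviation without its clause of minimality:
    unlike the exact value, the bound is monotone in [n] and is inherited along
    strictly monotone maps. *)
Inductive dev_le {d} {T : porderType d} : W -> set T -> Prop :=
  DevLe n (A : set T) :
    (forall a, descending_chain A a -> exists k, forall i, (k <= i)%N ->
       trivial_poset (poset_factor A (a i.+1) (a i)) \/
       exists2 m, (m < n)%O & dev_le m (poset_factor A (a i.+1) (a i))) ->
    dev_le n A.

Definition dev_at_most {d} {T : porderType d} (delta : option W) (A : set T) :=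
  if delta is Some n then dev_le n A else trivial_poset A.

Definition dev_lt {d} {T : porderType d} (n : W) (A : set T) :=
  exists2 delta : option W,
    (if delta is Some m then (m < n)%O else true) & dev_at_most delta A.

Lemma dev_leP {d} {T : porderType d} n (A : set T) :
  dev_le n A <->
  forall a, descending_chain A a -> exists k, forall i, (k <= i)%N ->
    dev_lt n (poset_factor A (a i.+1) (a i)).
Proof.
split=> [[{A}m A dA] a /dA[k ka]|dA].
  exists k => i /ka[triv|[m' m'm dA']]; first by exists None.
  by exists (Some m').
constructor=> a /dA[k ka]; exists k => i /ka[[m|] mn dm]; last by left.
by right; exists m.
Qed.

Lemma dev_le_trans {d} {T : porderType d} m n (A : set T) :
  (m <= n)%O -> dev_le m A -> dev_le n A.
Proof.
move=> mn /dev_leP dA; apply/dev_leP => a /dA[k ka]; exists k => i /ka[[m'|] m'm dm].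
  by exists (Some m') => //; exact: lt_le_trans mn.
by exists None.
Qed.

Lemma trivial_dev_le {d} {T : porderType d} n (A : set T) :
  trivial_poset A -> dev_le n A.
Proof.
move=> tA; apply/dev_leP => a _; exists 0%N => i _; exists None => //.
by move=> x y [Ax _] [Ay _]; exact: tA.
Qed.

Lemma dev_at_most_trivial {d} {T : porderType d} delta (A : set T) :
  trivial_poset A -> dev_at_most delta A.
Proof. by case: delta => //= n; exact: trivial_dev_le. Qed.

(** Both images of a descending chain have small factors from some point on, and
    the two maps restrict to a strict pair on each factor of the chain, so
    well-founded induction on the bound applies. *)
Lemma dev_at_most_pair {d d1 d2} {T : porderType d} {T1 : porderType d1}
    {T2 : porderType d2} (A : set T) (A1 : set T1) (A2 : set T2)
    (f1 : T -> T1) (f2 : T -> T2) delta :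
  strict_pair A A1 A2 f1 f2 ->
  dev_at_most delta A1 -> dev_at_most delta A2 -> dev_at_most delta A.
Proof.
case: delta => [n|] /=; last first.
  move=> [A1f A2f f1le f2le f12] t1 t2 x y Ax Ay xy; apply: f12 => //.
    by apply: t1; [exact: A1f|exact: A1f|exact: f1le].
  by apply: t2; [exact: A2f|exact: A2f|exact: f2le].
elim/(well_founded_ind (@wo_wf W)): n => n IH in A A1 A2 *.
move=> [A1f A2f f1le f2le f12] /dev_leP d1A /dev_leP d2A.
apply/dev_leP => a [Aa adesc].
have [|k1 k1a] := d1A (f1 \o a).
  by split=> i /=; [exact: A1f | exact: f1le].
have [|k2 k2a] := d2A (f2 \o a).
  by split=> i /=; [exact: A2f | exact: f2le].
exists (maxn k1 k2) => i; rewrite geq_max => /andP[/k1a dev1 /k2a dev2].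
set F := poset_factor A _ _.
have F1 x : F x -> poset_factor A1 (f1 (a i.+1)) (f1 (a i)) (f1 x).
  by case=> Ax /andP[x1 x2]; split; [exact: A1f|rewrite !f1le].
have F2 x : F x -> poset_factor A2 (f2 (a i.+1)) (f2 (a i)) (f2 x).
  by case=> Ax /andP[x1 x2]; split; [exact: A2f|rewrite !f2le].
have leF1 x y : F x -> F y -> (x <= y)%O -> (f1 x <= f1 y)%O.
  by case=> Ax _ [Ay _]; exact: f1le.
have leF2 x y : F x -> F y -> (x <= y)%O -> (f2 x <= f2 y)%O.
  by case=> Ax _ [Ay _]; exact: f2le.
have F12 x y : F x -> F y -> (x <= y)%O -> f1 x = f1 y -> f2 x = f2 y -> x = y.
  by case=> Ax _ [Ay _]; exact: f12.
have dev_of m : (m < n)%O ->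
    dev_le m (poset_factor A1 ((f1 \o a) i.+1) ((f1 \o a) i)) ->
    dev_le m (poset_factor A2 ((f2 \o a) i.+1) ((f2 \o a) i)) -> dev_lt n F.
  move=> mn dm1 dm2; exists (Some m) => //=.
  by apply: (IH m mn) dm1 dm2; split.
case: dev1 dev2 => -[m1|] /= m1n dm1 [[m2|] /= m2n dm2].
- have [m12|/ltW m21] := leP m1 m2.
    exact: dev_of m2n (dev_le_trans m12 dm1) dm2.
  exact: dev_of m1n dm1 (dev_le_trans m21 dm2).
- exact: dev_of m1n dm1 (trivial_dev_le _ dm2).
- exact: dev_of m2n (trivial_dev_le _ dm1) dm2.
- exists None => //= x y Fx Fy xy; apply: F12 => //.
    by apply: dm1; [exact: F1|exact: F1|exact: leF1].
  by apply: dm2; [exact: F2|exact: F2|exact: leF2].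
Qed.

Lemma dev_at_most_strict {d d'} {T : porderType d} {T' : porderType d'}
    (A : set T) (A' : set T') (f : T -> T') delta :
  (forall x, A x -> A' (f x)) ->
  (forall x y, A x -> A y -> (x <= y)%O -> (f x <= f y)%O) ->
  (forall x y, A x -> A y -> (x <= y)%O -> f x = f y -> x = y) ->
  dev_at_most delta A' -> dev_at_most delta A.
Proof.
move=> A'f fle finj dA'.
apply: (@dev_at_most_pair _ _ _ _ _ _ _ A' A' f f) (dA') (dA').
by split=> // x y Ax Ay xy e _; exact: finj.
Qed.

Lemma dev_at_most_sub {d} {T : porderType d} (A A' : set T) delta :
  A `<=` A' -> dev_at_most delta A' -> dev_at_most delta A.
Proof. by move=> AA'; apply: (@dev_at_most_strict _ _ _ _ _ _ id). Qed.

Lemma has_deviationE {d} {T : porderType d} (A : set T) (n : W) :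
  has_deviation A (Some n) <->
  deviation_step (fun (m : W) (_ : (m < n)%O) F => has_deviation F (Some m)) A.
Proof.
rewrite /= Fix_eq //; move=> x f g fg.
suff -> : f = g by [].
by apply: functional_extensionality_dep => y;
   apply: functional_extensionality_dep => yx; exact: fg.
Qed.

(** At the least element of [W] the bound [dev_le] is the descending chain
    condition, since a factor is trivial exactly when its ends agree; so the
    separate clause for deviation 0 fits the general pattern. *)
Lemma has_deviationP {d} {T : porderType d} (A : set T) (n : W) :
  has_deviation A (Some n) <-> dev_le n A /\ ~ dev_lt n A.
Proof.
elim/(well_founded_ind (@wo_wf W)): n => n IH in A *.
(* The least bound below [n] is the exact deviation. *)
have below (F : set T) : trivial_poset F \/
    (exists m, exists _ : (m < n)%O, has_deviation F (Some m)) <-> dev_lt n F.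
  split=> [[tF|[m [mn hm]]]|[[m|] mn /= dm]].
  - by exists None.
  - by exists (Some m) => //; have [] := (IH m mn F).1 hm.
  - elim/(well_founded_ind (@wo_wf W)): m => m IHm in mn dm *.
    have [[[m'|] /= m'm dm']|ndm] := pselect (dev_lt m F); last 1 first.
    + by right; exists m, mn; apply/(IH m mn F).
    + by apply: (IHm m') => //; exact: lt_trans mn.
    + by left.
  - by left.
rewrite has_deviationE; split.
  case=> [[nmin [ntA dccA]]|[_ [ntA chA]]].
    split; last first.
      case=> -[m|] //= mn _; have := lt_le_trans mn (nmin m).
      by rewrite ltxx.
    apply/dev_leP => a ca; have [k ka] := dccA _ ca.
    exists k => i /ka ai; exists None => // x y [_ xi] [_ yi] _.
    move: xi yi; rewrite ai => /le_anti <- /le_anti <- //.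
  split; last by rewrite -below.
  apply/dev_leP => a /chA[k ka]; exists k => i /ka.
  by rewrite below.
move=> [/dev_leP dA ndA].
have [nmin|] := pselect (forall m : W, (n <= m)%O).
  left; split=> //; split.
    by move=> tA; apply: ndA; exists None.
  move=> a /[dup] [[Aa ale]] /dA[k ka]; exists k => i /ka[[m|] //= mn].
    by have := lt_le_trans mn (nmin m); rewrite ltxx.
  by apply => //; split=> //; rewrite lexx ?ale.
move=> /existsNP[m /negP]; rewrite -ltNge => mn; right; split; first by exists m.
split; first by rewrite below.
by move=> a /dA[k ka]; exists k => i /ka; rewrite below.
Qed.

(** The deviation is the least bound, so equal sets of bounds give equal
    deviations. *)
Lemma same_deviation {d d'} {T : porderType d} {T' : porderType d'}
    (A : set T) (A' : set T') n :
  (forall delta, dev_at_most delta A <-> dev_at_most delta A') ->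
  dev_le n A ->
  exists delta : option W, has_deviation A delta /\ has_deviation A' delta.
Proof.
move=> eqd; elim/(well_founded_ind (@wo_wf W)): n => n IH dA.
have [[[m|] //= mn dm]|ndA] := pselect (dev_lt n A); first exact: IH dm.
  by exists None; split=> //; exact/(eqd None).
exists (Some n); split; apply/has_deviationP; split=> //.
  exact/(eqd (Some n)).
by move=> [delta dn /eqd dA']; apply: ndA; exists delta.
Qed.

End DeviationBound.

(** * Ranks of a well-founded relation *)

Section RankOrder.
Context {X : Type} {R : X -> X -> Prop}.

(** Comparison of the ordinal ranks of [x] and [y] for the well-founded relation
    [R], without ordinals. *)
Inductive rank_le : X -> X -> Prop :=
  RankLe x y : (forall x', R x' x -> exists2 y', R y' y & rank_le x' y') ->
    rank_le x y.

Definition rank_class (x : X) : set X := [set y | rank_le y x].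

(** An ordinal rank is represented by the set of elements of rank at most it;
    inclusion then orders the ranks. *)
Definition ranks (wfR : well_founded R) :=
  {S : set X | `[< exists x, S = rank_class x >]}.

Context (wfR : well_founded R).

Lemma rank_le_refl x : rank_le x x.
Proof.
elim/(well_founded_ind wfR): x => x IH.
by constructor=> y yx; exists y => //; exact: IH.
Qed.

Lemma rank_le_lt x y z : rank_le x y -> R z x -> exists2 y', R y' y & rank_le z y'.
Proof. by case=> {}x {}y xy; exact: xy. Qed.

Lemma rank_le_trans x y z : rank_le x y -> rank_le y z -> rank_le x z.
Proof.
elim/(well_founded_ind wfR): x => x IH in y z *; move=> xy yz.
constructor=> x' x'x.
have [y' y'y x'y'] := rank_le_lt xy x'x; have [z' z'z y'z'] := rank_le_lt yz y'y.
by exists z' => //; exact: IH y'z'.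
Qed.

Lemma not_rank_le x y : ~ rank_le x y -> exists2 x', R x' x & rank_le y x'.
Proof.
elim/(well_founded_ind wfR): x => x IH in y *; move=> nxy.
apply: contra_notP nxy => nx; constructor=> x' x'x.
have [//|nx'] := pselect (exists2 y', R y' y & rank_le x' y').
exfalso; apply: nx; exists x' => //; constructor=> y' y'y.
by apply: IH => // x'y'; apply: nx'; exists y'.
Qed.

Lemma rank_le_irr x y : R y x -> ~ rank_le x y.
Proof.
elim/(well_founded_ind wfR): x => x IH in y *; move=> yx xy.
have [z zy yz] := rank_le_lt xy yx; exact: IH yz.
Qed.

Lemma rank_le_pred x y : R x y -> rank_le x y.
Proof.
elim/(well_founded_ind wfR): x => x IH in y *; move=> xy.
by constructor=> z zx; exists x => //; exact: IH.
Qed.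

Lemma rank_class_sub x y : (rank_class x `<=` rank_class y) <-> rank_le x y.
Proof.
split=> [|xy z zx]; first by apply; exact: rank_le_refl.
exact: rank_le_trans zx xy.
Qed.

HB.instance Definition _ := SubChoice.on (ranks wfR).
HB.instance Definition _ :=
  [SubChoice_isSubPOrder of ranks wfR by <: with set_display].

Lemma ranks_leP (S S' : ranks wfR) : (S <= S')%O <-> (val S `<=` val S').
Proof. by rewrite -subsetEset Order.le_val. Qed.

Lemma ranks_total : total (<=%O : rel (ranks wfR)).
Proof.
move=> [S /[dup]/asboolP[x ->] Sx] [S' /[dup]/asboolP[y ->] Sy].
apply/orP; rewrite !ranks_leP /= !rank_class_sub.
have [xy|nxy] := pselect (rank_le x y); first by left.
have [x' x'x yx'] := not_rank_le nxy.
by right; exact: rank_le_trans yx' (rank_le_pred x'x).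
Qed.

HB.instance Definition _ :=
  Order.POrder_isTotal.Build set_display (ranks wfR) ranks_total.

Definition rank (x : X) : ranks wfR :=
  exist _ (rank_class x) (asboolT (ex_intro _ x erefl)).

Lemma rank_ltE x y : (rank x < rank y)%O <-> ~ rank_le y x.
Proof.
rewrite ltNge; split=> [/negP + yx|nyx].
  by apply; apply/ranks_leP/rank_class_sub.
by apply/negP => /ranks_leP /= /rank_class_sub.
Qed.

Lemma rank_lt x y : R x y -> (rank x < rank y)%O.
Proof. by move=> xy; apply/rank_ltE/rank_le_irr. Qed.

Lemma ranks_wf : well_founded (fun u v : ranks wfR => (u < v)%O).
Proof.
have rankP (u : ranks wfR) : exists x, u = rank x.
  by case: u => S Su; have /asboolP[x Sx] := Su; exists x; exact: val_inj.
suff acc x y : rank_le y x -> Acc (fun u v : ranks wfR => (u < v)%O) (rank y).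
  by move=> u; have [x ->] := rankP u; exact: acc (rank_le_refl x).
elim/(well_founded_ind wfR): x => x IH in y *; move=> yx.
constructor=> u; have [z ->] := rankP u; move=> /rank_ltE/not_rank_le[y' y'y zy'].
have [x' x'x y'x'] := rank_le_lt yx y'y.
exact: IH x'x _ (rank_le_trans zy' y'x').
Qed.

Definition rank_order : wellOrder := WellOrder ranks_wf.

End RankOrder.

(** * Ascending chains and the existence of the deviation *)

Definition ACC {d} {T : porderType d} (A : set T) : Prop :=
  forall a : nat -> T, (forall i, A (a i)) -> (forall i, (a i <= a i.+1)%O) ->
    exists k, forall i, (k <= i)%N -> a i = a k.

Section AscendingChains.
Context {d : Order.disp_t} {T : porderType d}.
Implicit Types A : set T.

Definition above_in A (y x : T) : Prop := [/\ A x, A y & (x < y)%O].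

Lemma ACC_wf A : ACC A -> well_founded (above_in A).
Proof.
move=> accA x; apply: contrapT => nx.
pose Bad := {x | ~ Acc (above_in A) x}.
have next (u : Bad) : {v : Bad | above_in A (sval v) (sval u)}.
  case: u => y ny; apply: cid; apply: contrapT => noy; apply: (ny).
  by constructor=> z zy; apply: contrapT => nz; apply: noy; exists (exist _ z nz).
pose a i := iter i (fun u => sval (next u)) (exist _ x nx).
have aS i : above_in A (sval (a i.+1)) (sval (a i)) := svalP (next (a i)).
have [i|i|k /(_ k.+1 (leqnSn _)) ak] := accA (fun i => sval (a i)).
- by case: (aS i).
- by case: (aS i) => _ _ /ltW.
- by case: (aS k) => _ _; rewrite ak ltxx.
Qed.

Lemma ACC_maximal A (P : set T) :
  ACC A -> P `<=` A -> P !=set0 ->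
  exists2 x, P x & forall y, P y -> (x <= y)%O -> y = x.
Proof.
move=> accA PA [x Px].
elim/(well_founded_ind (ACC_wf accA)): x => x IH in Px *.
have [|nx] := pselect (exists2 y, P y & (x < y)%O).
  by move=> [y Py xy]; apply: (IH y) => //; split=> //; exact: PA.
exists x => // y Py; rewrite le_eqVlt => /orP[/eqP//|xy].
by case: nx; exists y.
Qed.

(** The counterpart of [dev_at_most_pair] for ascending chains. *)
Lemma ACC_pair {d1 d2} {T1 : porderType d1} {T2 : porderType d2}
    A (A1 : set T1) (A2 : set T2) (f1 : T -> T1) (f2 : T -> T2) :
  strict_pair A A1 A2 f1 f2 ->
  ACC A1 -> ACC A2 -> ACC A.
Proof.
move=> [A1f A2f f1le f2le f12] acc1 acc2 a Aa ale.
have [i|i|k1 k1P] := acc1 (f1 \o a); [exact: A1f|exact: f1le|].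
have [i|i|k2 k2P] := acc2 (f2 \o a); [exact: A2f|exact: f2le|].
have le_a i j : (i <= j)%N -> (a i <= a j)%O.
  by apply: (@homo_leq _ a (fun x y => (x <= y)%O)) => // y x z; exact: le_trans.
exists (maxn k1 k2) => i ki; apply/esym.
move: (ki); rewrite geq_max => /andP[k1i k2i].
apply: f12 => //; first exact: le_a.
  by move: (k1P i k1i) (k1P (maxn k1 k2) (leq_maxl _ _)) => /= -> ->.
by move: (k2P i k2i) (k2P (maxn k1 k2) (leq_maxr _ _)) => /= -> ->.
Qed.

(** The rank of [x] for the reversed order bounds the deviation of the elements
    above [x]: in a chain that never reaches [x], the factor above [a i.+1] lies
    above an element of smaller rank, and a chain that reaches [x] is stationary
    from there on. *)
Lemma ACC_dev_le A b :
  ACC A -> A b -> (forall x, A x -> (b <= x)%O) ->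
  exists (W : wellOrder) (n : W), dev_le n A.
Proof.
move=> accA Ab bmin; pose rk := rank (ACC_wf accA).
suff devb c : A c ->
    @dev_le (rank_order (ACC_wf accA)) _ _ (rk c) [set x | A x /\ (c <= x)%O].
  exists (rank_order (ACC_wf accA)), (rk b).
  apply: (@dev_at_most_sub _ _ _ _ _ (Some _)) (devb b Ab) => x Ax.
  by split=> //; exact: bmin.
elim/(well_founded_ind (ACC_wf accA)): c => c IH Ac.
apply/dev_leP => a [aA ale].
have [[k akc]|nc] := pselect (exists k, a k = c).
  have ac i : (k <= i)%N -> a i = c.
    elim: i => [|i IHi]; first by rewrite leqn0 => /eqP <-.
    rewrite leq_eqVlt => /orP[/eqP <-//|/IHi aic].
    by apply/le_anti; have [_ ->] := aA i.+1; rewrite -aic ale.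
  exists k => i ki; exists None => //= x y [_ xc] [_ yc] _.
  move: xc yc; rewrite (ac i ki) (ac i.+1 (leqW ki)) => /le_anti <- /le_anti <- //.
exists 0%N => i _; have [Aai cai] := aA i.+1.
have c_lt : above_in A (a i.+1) c.
  split=> //; rewrite lt_neqAle cai andbT; apply/eqP => cE.
  by apply: nc; exists i.+1.
exists (Some (rk (a i.+1) : rank_order (ACC_wf accA))).
  exact: (rank_lt (ACC_wf accA)).
apply: (@dev_at_most_sub _ _ _ _ _ (Some _)) (IH _ c_lt Aai).
by move=> x [[Ax _] /andP[]].
Qed.

End AscendingChains.

(** * Subgroups of finitely generated abelian groups *)

Section Subgroups.
Context {G : groupType}.
Implicit Types H K : set G.

Lemma subgroup1 H : is_subgroup H -> H 1.
Proof. by case. Qed.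

Lemma subgroupF H x y : is_subgroup H -> H x -> H y -> H (x / y).
Proof. by case=> _; apply. Qed.

Lemma subgroupV H x : is_subgroup H -> H x -> H x^-1.
Proof. by move=> sH Hx; rewrite -div1g; exact: (subgroupF sH (subgroup1 sH)). Qed.

Lemma subgroupM H x y : is_subgroup H -> H x -> H y -> H (x * y).
Proof.
move=> sH Hx Hy; rewrite -[y]invgK.
exact: (subgroupF sH Hx (subgroupV sH Hy)).
Qed.

Lemma subgroup_mulr H x y : is_subgroup H -> H y -> H (x * y) <-> H x.
Proof.
move=> sH Hy; split=> [Hxy|Hx]; last exact: subgroupM.
by rewrite -[x](mulgK y); exact: subgroupF.
Qed.

Lemma subgroup_setI H K : is_subgroup H -> is_subgroup K -> is_subgroup (H `&` K).
Proof.
move=> sH sK; split; first by split; exact: subgroup1.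
by move=> x y [Hx Kx] [Hy Ky]; split; exact: subgroupF.
Qed.

Lemma subgroup_set1 : is_subgroup [set 1 : G].
Proof. by split=> // x y /= -> ->; rewrite divgg. Qed.

Lemma generated_sub H (S : set G) : is_subgroup H -> S `<=` H -> generated S `<=` H.
Proof. exact: smallest_sub. Qed.

Lemma sub_generated (S : set G) : S `<=` generated S.
Proof. exact: sub_gen_smallest. Qed.

Lemma generated_subgroup (S : set G) : is_subgroup (generated S).
Proof.
split=> [A [sA _]|x y Sx Sy A AS]; first exact: subgroup1.
by apply: subgroupF; [case: AS|exact: Sx|exact: Sy].
Qed.

Definition prod_set H K : set G := [set x | exists u v, [/\ H u, K v & x = u * v]].

Lemma sub_prod_setl H K : K 1 -> H `<=` prod_set H K.
Proof. by move=> K1 x Hx; exists x, 1; rewrite mulg1. Qed.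

Lemma sub_prod_setr H K : H 1 -> K `<=` prod_set H K.
Proof. by move=> H1 x Kx; exists 1, x; rewrite mul1g. Qed.

Lemma prod_set_sub H K L :
  is_subgroup L -> H `<=` L -> K `<=` L -> prod_set H K `<=` L.
Proof.
move=> sL HL KL _ [u [v [Hu Kv ->]]].
by apply: subgroupM => //; [exact: HL|exact: KL].
Qed.

End Subgroups.

Section AbelianGroups.
Context {G : groupType} (abG : abelian_group G).
Implicit Types H K : set G.

Lemma abelian_mulC (x y : G) : x * y = y * x.
Proof. exact: abG. Qed.

Lemma abelian_mulACA (x y z t : G) : (x * y) * (z * t) = (x * z) * (y * t).
Proof. by rewrite !mulgA -(mulgA x) (abelian_mulC y z) !mulgA. Qed.

Lemma abelian_divM (x y z t : G) : (x * y) / (z * t) = (x / z) * (y / t).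
Proof. by rewrite invgM (abelian_mulC t^-1) abelian_mulACA. Qed.

Lemma subgroup_prod_set H K :
  is_subgroup H -> is_subgroup K -> is_subgroup (prod_set H K).
Proof.
move=> sH sK; split.
  by exists 1, 1; rewrite mulg1; split=> //; exact: subgroup1.
move=> _ _ [u [v [Hu Kv ->]]] [u' [v' [Hu' Kv' ->]]].
by exists (u / u'), (v / v'); rewrite abelian_divM; split=> //; exact: subgroupF.
Qed.

Definition powers (g : G) : set G := [set z | exists k, z = g ^+ k \/ z = g ^- k].

Lemma powers_subgroup g : is_subgroup (powers g).
Proof.
split; first by exists 0%N; left.
have powF k l : powers g (g ^+ k / g ^+ l).
  have [lk|/ltnW kl] := leqP l k.
    by exists (k - l)%N; left; rewrite expgnFr.
  by exists (l - k)%N; right; rewrite expgnFr // invgF.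
have powM k l : g ^+ k * g ^+ l = g ^+ (k + l) by rewrite expgnDr.
move=> _ _ [k [->|->]] [l [->|->]].
- exact: powF.
- by exists (k + l)%N; left; rewrite invgK powM.
- by exists (l + k)%N; right; rewrite -powM invgM.
- by rewrite invgK abelian_mulC; exact: powF.
Qed.

Definition subgroups_in (N : set G) : set (set G) :=
  [set X | is_subgroup X /\ X `<=` N].

Lemma ascending {T : Type} (X : nat -> set T) :
  (forall i, (X i <= X i.+1)%O) -> forall i j, (i <= j)%N -> X i `<=` X j.
Proof.
move=> Xi; apply: (@homo_leq _ X (@subset T)) => [Y|Y X' Z|i].
- exact: subset_refl.
- exact: subset_trans.
- by rewrite -subsetEset.
Qed.

(** A subgroup [X] of the product is determined, in a chain, by its intersection
    with [N] and by the exponents of [g] that occur in it modulo [N]; the latter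
    form an ideal of the integers, governed by its least positive element. *)
Lemma ACC_adjoin (N : set G) g :
  is_subgroup N -> ACC (subgroups_in N) ->
  ACC (subgroups_in (prod_set N (powers g))).
Proof.
move=> sN accN X XN Xi; have Xle := ascending Xi.
have sX j : is_subgroup (X j) by case: (XN j).
have [|i|k1 Xk1] := accN (fun j => X j `&` N).
- by move=> i; split=> [|x []//]; exact: subgroup_setI.
- by rewrite subsetEset; apply: setSI; rewrite -subsetEset.
have inN j x : (k1 <= j)%N -> X j x -> N x -> X k1 x.
  by move=> kj Xx Nx; have /seteqP[/(_ x)[]] := Xk1 _ kj.
(* Up to inversion every element has a nonnegative exponent of [g]. *)
have wlog_pos j J : (forall u m, N u -> X j (u * g ^+ m) -> X J (u * g ^+ m)) ->
    X j `<=` X J.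
  move=> pos y Xy; have [_ /(_ y Xy)[u [v [Nu [m [->|->]] yE]]]] := XN j.
    by rewrite yE; apply: pos => //; rewrite -yE.
  have yVE : y^-1 = u^-1 * g ^+ m by rewrite yE invgM invgK abelian_mulC.
  rewrite -[y]invgK; apply: subgroupV => //; rewrite yVE.
  by apply: pos; [exact: subgroupV | rewrite -yVE; exact: subgroupV].
(* Exponents of [g] that occur in the chain modulo [N]; if there is a least one
   [k], every element reduces to [N] by subtracting multiples of [w * g ^+ k]. *)
pose lead := [set m | (0 < m)%N /\ exists j u, N u /\ X j (u * g ^+ m)].
have [[k [k0 [j0 [w [Nw Xw]]]] kmin]|no_lead] :
    (exists2 k, lead k & forall m, lead m -> (k <= m)%N) \/ ~ exists k, lead k.
  have [[k lk]|] := pselect (exists k, lead k); last by right.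
  left; have ex : exists k, `[< lead k >] by exists k; exact/asboolP.
  case: (ex_minnP ex) => {lk}k /asboolP lk kmin.
  by exists k => // m lm; exact/kmin/asboolP.
- exists (maxn j0 k1) => j; rewrite geq_max => /andP[j0j k1j].
  apply/seteqP; split; last by apply: Xle; rewrite geq_max j0j.
  apply: wlog_pos => u m; have [n mn] := ubnP m.
  elim: n m mn u => // n IH m; rewrite ltnS => mn u Nu Xu.
  have XJw : X (maxn j0 k1) (w * g ^+ k) by apply: Xle Xw; exact: leq_maxl.
  have [km|mk] := leqP k m.
    have uE : u * g ^+ m = (u / w) * g ^+ (m - k) * (w * g ^+ k).
      by rewrite expgnFr // -abelian_divM mulgVK.
    rewrite uE; apply: subgroupM => //; apply: IH.
    + by rewrite (leq_trans _ mn) // ltn_subrL k0 (leq_trans k0).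
    + exact: subgroupF.
    + apply/(@subgroup_mulr _ _ _ (w * g ^+ k)); rewrite -?uE //.
      exact: Xle Xw.
  case: (posnP m) => [m0|m_gt0]; last first.
    have /kmin : lead m by split=> //; exists j, u.
    by rewrite leqNgt mk.
  move: Xu; rewrite m0 mulg1 => Xu; apply: (Xle k1); first exact: leq_maxr.
  exact: inN Xu Nu.
- exists k1 => j k1j; apply/seteqP; split; last exact: Xle.
  apply: wlog_pos => u m Nu Xu; case: (posnP m) => [m0|m_gt0]; last first.
    by case: no_lead; exists m; split=> //; exists j, u.
  by move: Xu; rewrite m0 mulg1 => Xu; exact: inN Xu Nu.
Qed.

Lemma ACC_set1 : ACC (subgroups_in [set 1]).
Proof.
move=> X XN _; exists 0%N => i _.
have X1 j : X j = [set 1].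
  by have [sX X1] := XN j; apply/seteqP; split=> // _ ->; exact: subgroup1.
by rewrite !X1.
Qed.

Lemma ACC_fg (s : seq G) :
  exists2 N, is_subgroup N /\ [set` s] `<=` N & ACC (subgroups_in N).
Proof.
elim: s => [|g s [N [sN Ns] accN]].
  exists [set 1]; last exact: ACC_set1.
  by split=> //; exact: subgroup_set1.
exists (prod_set N (powers g)); last exact: ACC_adjoin.
have sP := powers_subgroup g.
split=> [|x /=]; first exact: subgroup_prod_set.
rewrite inE => /predU1P[->|/Ns Nx].
  by apply: sub_prod_setr; [exact: subgroup1|exists 1%N; left].
by apply: sub_prod_setl => //; exact: subgroup1.
Qed.

End AbelianGroups.

(** * Hilbert's basis theorem for groups with operators *)

Section Submodules.
Context {Q B : groupType} (a : automorphic_action Q B).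
Implicit Types (S : set Q) (X Y N : set B).

Definition submodules S : set (set B) :=
  [set X | is_subgroup X /\ forall q x, S q -> X x -> X (a q x)].

Definition submodules_in S N : set (set B) :=
  [set X | submodules S X /\ X `<=` N].

Lemma act_byV q (b : B) : a q b^-1 = (a q b)^-1.
Proof. by apply/esym/mulg1_eq; rewrite -act_byMr mulgV act_by_one. Qed.

Lemma act_byF q (b c : B) : a q (b / c) = a q b / a q c.
Proof. by rewrite act_byMr act_byV. Qed.

Lemma submodule_setI S X Y :
  submodules S X -> submodules S Y -> submodules S (X `&` Y).
Proof.
move=> [sX aX] [sY aY]; split=> [|q x Sq [Xx Yx]]; first exact: subgroup_setI.
by split; [exact: aX|exact: aY].
Qed.

Lemma submodule_set1 S : submodules S [set 1].
Proof. by split=> [|q x _ /= ->]; [exact: subgroup_set1|exact: act_by_one]. Qed.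

Lemma subset_submodules S S' X : S `<=` S' -> submodules S' X -> submodules S X.
Proof. by move=> SS' [sX aX]; split=> // q x /SS'; exact: aX. Qed.

Hypothesis abQ : abelian_group Q.

Lemma act_byC q r b : a q (a r b) = a r (a q b).
Proof. by rewrite -!act_byM (abelian_mulC abQ). Qed.

Lemma submodule_image S X q : submodules S X -> submodules S (a q @` X).
Proof.
move=> [sX aX]; split; first split.
- by exists 1; rewrite ?act_by_one //; exact: subgroup1.
- move=> _ _ [x Xx <-] [y Xy <-]; exists (x / y); rewrite ?act_byF //.
  exact: subgroupF.
- by move=> r _ Sr [x Xx <-]; exists (a r x); rewrite 1?act_byC //; exact: aX.
Qed.

Hypothesis abB : abelian_group B.

Lemma submodule_prod S X Y :
  submodules S X -> submodules S Y -> submodules S (prod_set X Y).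
Proof.
move=> [sX aX] [sY aY]; split; first exact: subgroup_prod_set.
move=> q _ Sq [u [v [Xu Yv ->]]]; exists (a q u), (a q v).
by rewrite act_byMr; split=> //; [exact: aX|exact: aY].
Qed.

Section AdjoinOperator.
Variables (S : set Q) (x : Q) (N : set B).
Hypothesis (subN : submodules S N).

(** The polynomials of degree less than [n] in the operator [x], with
    coefficients in [N]. *)
Fixpoint poly_lt n : set B :=
  if n is m.+1 then prod_set (poly_lt m) (a (x ^+ m) @` N) else [set 1].

Definition poly_set : set B := [set b | exists n, poly_lt n b].

(** The coefficients of degree [n] of the elements of [X] of degree at most
    [n]. *)
Definition lead_set n X : set B :=
  [set b | N b /\ exists2 u, poly_lt n u & X (u * a (x ^+ n) b)].

Lemma poly_lt_submodule n : submodules S (poly_lt n).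
Proof.
elim: n => [|n IH] /=; first exact: submodule_set1.
exact: submodule_prod (submodule_image _ subN).
Qed.

Let poly_lt_sub n := (poly_lt_submodule n).1.

Lemma poly_ltS n : poly_lt n `<=` poly_lt n.+1.
Proof.
apply: sub_prod_setl; exists 1; last exact: act_by_one.
by apply: subgroup1; case: subN.
Qed.

Lemma poly_lt_mono m n : (m <= n)%N -> poly_lt m `<=` poly_lt n.
Proof. by apply: ascending => i; rewrite subsetEset; exact: poly_ltS. Qed.

Lemma poly_lt_act n u : poly_lt n u -> poly_lt n.+1 (a x u).
Proof.
elim: n u => [|n IH] u.
  by move=> /= ->; rewrite act_by_one; exact: (subgroup1 (poly_lt_sub 1)).
move=> [v [_ [Uv [b Nb <-] ->]]]; exists (a x v), (a (x ^+ n.+1) b).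
by rewrite act_byMr -act_byM -expgS; split; [exact: IH|exists b|].
Qed.

Lemma poly_set_submodule : submodules (x |` S) poly_set.
Proof.
split; [split; first by exists 0%N|].
- move=> u v [m Um] [n Un]; exists (maxn m n).
  by apply: subgroupF => //; [apply: poly_lt_mono Um|apply: poly_lt_mono Un];
     rewrite (leq_maxl, leq_maxr).
- move=> q u [->|Sq] [n Un]; first by exists n.+1; exact: poly_lt_act.
  by exists n; apply: (poly_lt_submodule n).2.
Qed.

Lemma sub_poly_set : N `<=` poly_set.
Proof.
move=> b Nb; exists 1%N, 1, b; split=> //; last by rewrite mul1g.
by exists b => //; rewrite act_by1.
Qed.

Lemma lead_set_submodule n X : submodules S X -> submodules_in S N (lead_set n X).
Proof.
move=> [sX aX]; have [sN aN] := subN; split; last by move=> b [].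
split; first split.
- split; first exact: subgroup1.
  by exists 1; rewrite ?act_by_one ?mulg1; exact: subgroup1.
- move=> b c [Nb [u Uu Xu]] [Nc [v Uv Xv]]; split; first exact: subgroupF.
  exists (u / v); first exact: subgroupF.
  by rewrite act_byF -abelian_divM //; exact: subgroupF.
- move=> q b Sq [Nb [u Uu Xu]]; split; first exact: aN.
  exists (a q u); first exact: (poly_lt_submodule n).2.
  by rewrite act_byC -act_byMr; exact: aX.
Qed.

Lemma lead_setS n X : submodules (x |` S) X -> lead_set n X `<=` lead_set n.+1 X.
Proof.
move=> [_ aX] b [Nb [u Uu Xu]]; split=> //; exists (a x u); first exact: poly_lt_act.
by rewrite expgS act_byM -act_byMr; apply: aX => //; left.
Qed.

Lemma lead_set_mono X : submodules (x |` S) X ->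
  forall m n, (m <= n)%N -> lead_set m X `<=` lead_set n X.
Proof. by move=> sX; apply: ascending => i; rewrite subsetEset; exact: lead_setS. Qed.

Lemma lead_set_sub n X Y : X `<=` Y -> lead_set n X `<=` lead_set n Y.
Proof. by move=> XY b [Nb [u Uu Xu]]; split=> //; exists u => //; exact: XY. Qed.

(** Induction on the degree: subtracting an element of [X] with the same leading
    coefficient lowers the degree of an element of [Y]. *)
Lemma sub_of_lead X Y : is_subgroup X -> is_subgroup Y -> X `<=` Y ->
  Y `<=` poly_set -> (forall n, lead_set n Y `<=` lead_set n X) -> Y `<=` X.
Proof.
move=> sX sY XY YU lead y Yy; have [n Un] := YU y Yy.
elim: n y Yy Un => [|n IH] y Yy; first by move=> /= ->; exact: subgroup1.
move=> [u [_ [Uu [b Nb <-] yE]]].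
have [_ [v Uv Xv]] : lead_set n X b.
  by apply: lead; split=> //; exists u; rewrite -?yE.
have yvE : y / (v * a (x ^+ n) b) = u / v by rewrite yE abelian_divM // divgg mulg1.
rewrite -(mulgVK (v * a (x ^+ n) b) y); apply: subgroupM => //.
apply: IH; first by apply: subgroupF => //; exact: XY.
by rewrite yvE; exact: subgroupF.
Qed.

(** Hilbert's basis theorem.  The leading coefficients [lead_set n (X j)] grow
    with [n] and with [j]; the diagonal chain bounds the relevant degrees, and
    each of the finitely many smaller degrees stabilises in [j]. *)
Lemma ACC_adjoin_operator :
  ACC (submodules_in S N) -> ACC (submodules_in (x |` S) poly_set).
Proof.
move=> accN X XU Xi; have Xle := ascending Xi.
have subX j : submodules (x |` S) (X j) by case: (XU j).
have subSX j : submodules S (X j).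
  by apply: subset_submodules (subX j) => q Sq; right.
have leadX n j : submodules_in S N (lead_set n (X j)) by exact: lead_set_submodule.
have [//|i|k0 Dk0] := accN (fun n => lead_set n (X n)).
  rewrite subsetEset; apply: subset_trans (lead_setS (subX i)) _.
  by apply: lead_set_sub; apply: Xle.
have tail n j : (k0 <= n)%N -> (k0 <= j)%N -> lead_set n (X j) = lead_set k0 (X k0).
  move=> kn kj; apply/seteqP; split; last first.
    apply: subset_trans (lead_set_mono (subX k0) kn) _.
    by apply: lead_set_sub; exact: Xle.
  rewrite -(Dk0 (maxn n j)) ?leq_max ?kn //.
  apply: subset_trans (lead_set_mono (subX j) (leq_maxl n j)) _.
  by apply: lead_set_sub; apply: Xle; exact: leq_maxr.
have /choice[k kP] n : exists kn, forall j, (kn <= j)%N ->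
    lead_set n (X j) = lead_set n (X kn).
  apply: (accN (fun j => lead_set n (X j))) => // i.
  by rewrite subsetEset; apply: lead_set_sub; exact: Xle.
(* From degree [k0] on, the diagonal controls the leading coefficients. *)
pose K := maxn k0 (\max_(n < k0) k n); exists K => j Kj.
have k0K : (k0 <= K)%N by exact: leq_maxl.
apply/seteqP; split; last exact: Xle.
apply: sub_of_lead; [by case: (subX K)|by case: (subX j)|exact: Xle|by case: (XU j)|].
move=> n; have [k0n|nk0] := leqP k0 n.
  by rewrite !tail // (leq_trans k0K).
have knK : (k n <= K)%N.
  by rewrite leq_max; apply/orP; right; exact: (leq_bigmax (Ordinal nk0)).
by rewrite kP ?(leq_trans knK) // (kP n K).
Qed.

End AdjoinOperator.

Lemma ACC_fg_submodule (xs : seq Q) (s : seq B) :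
  exists2 N, submodules [set` xs] N /\ [set` s] `<=` N &
    ACC (submodules_in [set` xs] N).
Proof.
elim: xs => [|x xs [N [subN sN] accN]].
  have [N [sN Ns] accN] := ACC_fg abB s.
  exists N; first by split=> //; split=> // q b.
  by move=> X XN; apply: accN => i; have [[sX _] XiN] := XN i.
have xsE : [set` x :: xs] = x |` [set` xs].
  apply/seteqP; split=> q /=; rewrite inE; first by move/predU1P.
  by move=> ?; apply/predU1P.
rewrite xsE; exists (poly_set x N); last exact: ACC_adjoin_operator.
split; first exact: poly_set_submodule.
exact: subset_trans sN (@sub_poly_set x N).
Qed.

Lemma submodules_generated (t : seq Q) X : generated [set` t] = setT ->
  submodules [set` t ++ map inv t] X -> submodules setT X.
Proof.
move=> tQ [sX aX]; split=> // q x _ Xx.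
(* Asking for both [q] and its inverse makes [H] a subgroup. *)
pose H := [set q | forall x, X x -> X (a q x) /\ X (a q^-1 x)].
suff : H q by move=> /(_ x Xx)[].
have : generated [set` t] q by rewrite tQ.
apply: generated_sub => {q x Xx}.
  split; first by move=> x Xx; rewrite invg1 !act_by1.
  move=> q r Hq Hr x Xx; rewrite invgF !act_byM; split.
    by apply Hq; apply Hr.
  by apply Hr; apply Hq.
move=> q tq x Xx; split; apply: aX => //=; rewrite mem_cat; apply/orP; first by left.
by right; exact: map_f.
Qed.

(** P. Hall's theorem: finitely generated modules over the integral group ring of
    a finitely generated abelian group are Noetherian. *)
Lemma ACC_fg_module (s : seq B) : finitely_generated Q ->
  exists2 N, submodules setT N /\ [set` s] `<=` N & ACC (submodules_in setT N).
Proof.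
move=> [t tQ]; have [N [subN sN] accN] := ACC_fg_submodule (t ++ map inv t) s.
exists N; first by split=> //; exact: submodules_generated subN.
move=> X XN; apply: accN => i; have [subX XiN] := XN i; split=> //.
exact: subset_submodules subX.
Qed.

End Submodules.

(** * Deviation of an essential extension *)

Section EssentialExtension.
Context {Q B : groupType} (a : automorphic_action Q B).
Hypotheses (abQ : abelian_group Q) (abB : abelian_group B).
Implicit Types (r s : B -> B) (b m : B) (C D F M N X Y : set B).

Local Notation Sub := (submodules a setT).

(** These maps stand in for the group ring of [Q] acting on [B].  Preserving all
    submodules is what makes the maps usable as ring elements in a quotient of
    [B]; it holds for sums and products of the maps [a q]. *)
Record scalar r : Prop := Scalar {
  scalarM : forall b c, r (b * c) = r b * r c;
  scalar_act : forall q b, r (a q b) = a q (r b);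
  scalar_sub : forall X, Sub X -> forall b, X b -> X (r b) }.

Lemma scalar1 r : scalar r -> r 1 = 1.
Proof. by move=> sr; apply: (mulgI (r 1)); rewrite -(scalarM sr) !mulg1. Qed.

Lemma scalarF r b c : scalar r -> r (b / c) = r b / r c.
Proof.
move=> sr; apply: (mulIg (r c)).
by rewrite -(scalarM sr) !mulgVK.
Qed.

Lemma scalar_id : scalar id.
Proof. by []. Qed.

Lemma scalar_comp r s : scalar r -> scalar s -> scalar (r \o s).
Proof.
move=> sr ss; split=> /= [b c|q b|X sX b Xb].
- by rewrite (scalarM ss) (scalarM sr).
- by rewrite (scalar_act ss) (scalar_act sr).
- by apply: (scalar_sub sr sX); exact: (scalar_sub ss sX).
Qed.

Lemma scalar_iter r n : scalar r -> scalar (iter n r).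
Proof.
by move=> sr; elim: n => [|n IH] /=; [exact: scalar_id | exact: (scalar_comp sr IH)].
Qed.

Lemma scalar_div r s : scalar r -> scalar s -> scalar (fun b => r b / s b).
Proof.
move=> sr ss; split=> [b c|q b|X sX b Xb].
- by rewrite (scalarM sr) (scalarM ss) abelian_divM.
- by rewrite (scalar_act sr) (scalar_act ss) act_byF.
- case: (sX) => sgX _; apply: (subgroupF sgX).
    exact: (scalar_sub sr sX).
  exact: (scalar_sub ss sX).
Qed.

Lemma scalar_of_act q : scalar (a q).
Proof.
split=> [b c|p b|X [_ aX] b]; first exact: act_byMr; first exact: act_byC.
exact: aX.
Qed.

Lemma submodule_preimage r X : scalar r -> Sub X -> Sub (r @^-1` X).
Proof.
move=> sr [sX aX]; split; first split.
- by rewrite /= (scalar1 sr); exact: subgroup1.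
- by move=> b c Xb Xc; rewrite /= (scalarF _ _ sr); exact: subgroupF.
- by move=> q b _ Xb; rewrite /= (scalar_act sr); exact: aX.
Qed.

Lemma submodule_range r : scalar r -> Sub (range r).
Proof.
move=> sr; split; first split.
- by exists 1; rewrite ?(scalar1 sr).
- by move=> _ _ [b _ <-] [c _ <-]; exists (b / c); rewrite ?(scalarF _ _ sr).
- by move=> q _ _ [b _ <-]; exists (a q b); rewrite ?(scalar_act sr).
Qed.

Lemma intervalP C D X : poset_factor Sub C D X <-> [/\ Sub X, C `<=` X & X `<=` D].
Proof.
rewrite /poset_factor /=; split=> [[sX /andP[]]|[sX CX XD]].
  by rewrite !subsetEset.
by split=> //; apply/andP; rewrite !subsetEset.
Qed.

Section Bounded.
Context {W : wellOrder} (delta : option W).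

Definition dev_interval C D := dev_at_most delta (poset_factor Sub C D).

Lemma dev_interval_trivial C D : D `<=` C -> dev_interval C D.
Proof.
move=> DC; apply: dev_at_most_trivial.
move=> X Y /intervalP[_ CX XD] /intervalP[_ CY YD] _.
have XC : X = C by apply/seteqP; split=> //; exact: subset_trans DC.
by rewrite XC; apply/seteqP; split=> //; exact: subset_trans DC.
Qed.

(** By modularity, [X |-> (X meet D, X D)] is strict on comparable
    submodules. *)
Lemma dev_interval_join C D F : Sub D -> C `<=` D -> D `<=` F -> Sub F ->
  dev_interval C D -> dev_interval D F -> dev_interval C F.
Proof.
move=> sD CD DF sF.
apply: (dev_at_most_pair (f1 := fun X => X `&` D) (f2 := fun X => prod_set X D));
  split.
- move=> X /intervalP[sX CX XF]; apply/intervalP; split=> [|x Cx|x []//].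
    exact: submodule_setI.
  by split; [exact: CX|exact: CD].
- move=> X /intervalP[sX CX XF]; apply/intervalP; split.
  + exact: submodule_prod.
  + by apply: sub_prod_setr; case: sX => [[]].
  + by apply: prod_set_sub => //; case: sF.
- by move=> X Y _ _; rewrite !subsetEset; exact: setSI.
- move=> X Y _ _; rewrite !subsetEset => XY _ [u [v [Xu Dv ->]]].
  by exists u, v; split=> //; exact: XY.
- move=> X Y /intervalP[[sX _] _ _] /intervalP[[sY _] _ _].
  rewrite subsetEset => XY eI eP; apply/seteqP; split=> // y Yy.
  have [u [v [Xu Dv yE]]] : prod_set X D y.
    by rewrite eP; apply: sub_prod_setl => //; case: sD => [[]].
  have [Xv _] : (X `&` D) v.
    rewrite eI; split=> //; rewrite -(mulKg u v) -yE.
    by apply: subgroupM => //; apply: subgroupV => //; exact: XY.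
  by rewrite yE; exact: subgroupM.
Qed.

(** Multiplication by the [i]-th power of [r] maps [B / C r B] onto the layer, so
    preimages embed the submodules of the layer in those of [B / C r B]. *)
Lemma dev_layer r C i : scalar r -> Sub C ->
  dev_interval (prod_set C (range r)) setT ->
  dev_interval (prod_set C (range (iter i.+1 r))) (prod_set C (range (iter i r))).
Proof.
move=> sr sC; have sri := scalar_iter i sr; have C1 : C 1 by case: sC => [[]].
have r1 n : range (iter n r) 1 by have [[]] := submodule_range (scalar_iter n sr).
apply: (dev_at_most_strict (f := fun X => iter i r @^-1` X)).
- move=> X /intervalP[sX CX _]; apply/intervalP; split=> //.
    exact: submodule_preimage.
  apply: prod_set_sub; first by case: (submodule_preimage sri sX).
    move=> c Cc; apply: (scalar_sub sri sX); apply: CX.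
    by apply: sub_prod_setl.
  move=> _ [b _ <-]; apply: CX; apply: sub_prod_setr => //.
  by exists b => //; rewrite iterSr.
- by move=> X Y _ _; rewrite !subsetEset => XY b; exact: XY.
- move=> X Y /intervalP[[sX _] CX _] /intervalP[[sY _] _ YD].
  rewrite subsetEset => XY eXY; apply/seteqP; split=> // y Yy.
  have [c [_ [Cc [b _ <-] yE]]] := YD y Yy.
  have Xc : X c by apply: CX; exact: sub_prod_setl.
  have : (iter i r @^-1` X) b.
    rewrite eXY /= -(mulKg c (iter i r b)) -yE; apply: subgroupM => //.
    by apply: subgroupV => //; exact: XY.
  by move=> /= Xb; rewrite yE; exact: subgroupM.
Qed.

Lemma dev_nilpotent r n C : scalar r -> (forall b, iter n r b = 1) -> Sub C ->
  dev_interval (prod_set C (range r)) setT -> dev_interval C setT.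
Proof.
move=> sr rn sC devC; have C1 : C 1 by case: sC => [[]].
have sP i : Sub (prod_set C (range (iter i r))).
  by apply: submodule_prod => //; apply/submodule_range/scalar_iter.
suff devi i : dev_interval (prod_set C (range (iter i r))) setT.
  have -> : C = prod_set C (range (iter n r)); last exact: devi.
  apply/seteqP; split=> [|_ [u [_ [Cu [b _ <-] ->]]]]; last by rewrite rn mulg1.
  by apply: sub_prod_setl; exists 1.
elim: i => [|i IH].
  apply: dev_interval_trivial => b _.
  by apply: sub_prod_setr => //; exists b.
apply: dev_interval_join (dev_layer i sr sC devC) IH => //.
move=> _ [u [_ [Cu [b _ <-] ->]]]; exists u, (iter i.+1 r b); split=> //.
by exists (r b) => //; rewrite -iterSr.
Qed.

End Bounded.

Hypothesis accB : ACC Sub.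

Variable M : set B.
Hypotheses (subM : Sub M).
Hypothesis essM : forall X, Sub X -> X `&` M `<=` [set 1] -> X `<=` [set 1].

(** Fitting's argument: the image of a high power of [r] meets its kernel
    trivially, and the kernel contains [M]; by essentiality the image is
    trivial. *)
Lemma killing_nilpotent r : scalar r -> (forall m, M m -> r m = 1) ->
  exists n, forall b, iter n r b = 1.
Proof.
move=> sr rM; pose K n := iter n r @^-1` [set 1].
have [n|n|k kP] := accB (a := K).
- by apply: submodule_preimage; [exact: scalar_iter|exact: submodule_set1].
- by rewrite subsetEset => b Kb; rewrite /K /preimage /= Kb; exact: scalar1.
(* The successor ensures that the power of [r] kills [M] even when [k] is 0. *)
exists k.+1 => b; have sk := scalar_iter k.+1 sr.
apply: (essM (submodule_range sk)); last by exists b.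
move=> _ [[c _ <-] Mc].
have Kc : iter (k.+1 + k.+1) r c = 1.
  by rewrite iterD [LHS]iterSr rM // (scalar1 (scalar_iter k sr)).
have : K (k.+1 + k.+1)%N c := Kc.
rewrite kP; last by rewrite addnS leqW // leq_addl.
by rewrite -(kP k.+1 (leqnSn k)).
Qed.

Definition kills r N := forall c, N c -> r c = 1.

(** The product of [b] by the annihilator of [N] in the ring of scalars; for
    trivial [N] this is the cyclic module of [b]. *)
Definition ann_orbit N b : set B :=
  [set c | exists r, [/\ scalar r, kills r N & c = r b]].

Lemma ann_orbit_submodule N b : Sub (ann_orbit N b).
Proof.
split; first split.
- exists (fun b => id b / id b); split; last by rewrite divgg.
    exact: scalar_div scalar_id scalar_id.
  by move=> c _; rewrite divgg.
- move=> _ _ [r [sr rN ->]] [s [ss sN ->]]; exists (fun b => r b / s b).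
  split=> //; first exact: scalar_div.
  by move=> c Nc; rewrite rN // sN // divgg.
- move=> q _ _ [r [sr rN ->]]; exists (a q \o r); split=> //.
    exact: scalar_comp (scalar_of_act q) sr.
  by move=> c Nc; rewrite /= rN // act_by_one.
Qed.

Lemma ann_orbit_anti N N' b : N `<=` N' -> ann_orbit N' b `<=` ann_orbit N b.
Proof. by move=> NN' _ [r [sr rN ->]]; exists r; split=> // c /NN'; exact: rN. Qed.

Lemma mem_orbit b : ann_orbit [set 1] b b.
Proof. by exists id; split=> //. Qed.

Definition adjoin N m : set B := smallest Sub (N `|` [set m]).

Lemma adjoin_submodule N m : Sub (adjoin N m).
Proof.
split; first split.
- by move=> X [[[]]].
- move=> b c Nb Nc X XN; case: (XN) => -[sX _] _.
  exact: subgroupF (Nb X XN) (Nc X XN).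
- by move=> q b _ Nb X XN; case: (XN) => -[_ aX] _; exact: aX (Nb X XN).
Qed.

Section MoreBounded.
Context {W : wellOrder} (delta : option W).
Hypothesis devM : dev_at_most delta (submodules_in a setT M).

(** Let [I] be the annihilator of [N] and [J] that of [N] and [m].  The layer
    between [D J b] and [D I b] is a quotient of [I / J], which is isomorphic to
    the submodule [I m] of [M]. *)
Lemma dev_ann_layer D N m b : Sub D -> M m ->
  dev_interval delta (prod_set D (ann_orbit (adjoin N m) b))
                     (prod_set D (ann_orbit N b)).
Proof.
move=> sD Mm; have D1 : D 1 by case: sD => [[]].
have o1 N' : ann_orbit N' b 1 by have [[]] := ann_orbit_submodule N' b.
(* [f X] is [J m], where [J] is the ideal of the [r] that kill [N] and send
   [b] into [X]. *)
pose f X := [set c | exists r, [/\ scalar r, kills r N, X (r b) & c = r m]].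
apply: (dev_at_most_strict (f := f) _ _ _ devM).
- move=> X /intervalP[[sX aX] _ _]; split; last first.
    by move=> _ [r [sr _ _ ->]]; exact: (scalar_sub sr subM).
  split; first split.
  + exists (fun b => id b / id b); split; rewrite ?divgg //.
    * exact: scalar_div scalar_id scalar_id.
    * by move=> c _; rewrite divgg.
    * exact: subgroup1.
  + move=> _ _ [r [sr rN Xr ->]] [s [ss sN Xs ->]]; exists (fun b => r b / s b).
    split=> //; [exact: scalar_div| |exact: subgroupF].
    by move=> c Nc; rewrite rN // sN // divgg.
  + move=> q _ _ [r [sr rN Xr ->]]; exists (a q \o r); split=> //.
    * exact: scalar_comp (scalar_of_act q) sr.
    * by move=> c Nc; rewrite /= rN // act_by_one.
    * exact: aX.
- move=> X Y _ _; rewrite !subsetEset => XY _ [r [sr rN Xr ->]].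
  by exists r; split=> //; exact: XY.
- move=> X Y /intervalP[[sX _] CX _] /intervalP[[sY _] _ YC].
  rewrite subsetEset => XY eXY; apply/seteqP; split=> // y Yy.
  have DX d : D d -> X d by move=> Dd; apply: CX; exact: sub_prod_setl.
  have [d [_ [Dd [r [sr rN ->]] yE]]] := YC y Yy.
  have Yr : Y (r b).
    rewrite -(mulKg d (r b)) -yE; apply: subgroupM => //.
    by apply: subgroupV => //; apply/XY/DX.
  have [s [ss sN Xs rsm]] : f X (r m) by rewrite eXY; exists r.
  rewrite yE; apply: subgroupM => //; first exact: DX.
  rewrite -(mulgVK (s b) (r b)); apply: subgroupM => //.
  apply/CX/sub_prod_setr => //; exists (fun b => r b / s b); split=> //.
    exact: scalar_div.
  have sK := submodule_preimage (scalar_div sr ss) (submodule_set1 a setT).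
  move=> c /(_ _ (conj sK _)); apply => {}c [Nc|->] /=.
    by rewrite rN // sN // divgg.
  by rewrite rsm divgg.
Qed.

(** A maximal submodule [N] of [M] for which the top part of the filtration is
    bounded must be [M] itself, since any further [m] adds one bounded layer. *)
Lemma dev_annihilated_orbit D b : Sub D -> ann_orbit M b `<=` D ->
  dev_interval delta D (prod_set D (ann_orbit [set 1] b)).
Proof.
move=> sD MbD; have D1 : D 1 by case: sD => [[]].
have sP N : Sub (prod_set D (ann_orbit N b)).
  by apply: submodule_prod => //; exact: ann_orbit_submodule.
pose P := [set N | [/\ Sub N, N `<=` M & dev_interval delta
  (prod_set D (ann_orbit N b)) (prod_set D (ann_orbit [set 1] b))]].
have [||N [sN NM devN] Nmax] := @ACC_maximal _ _ Sub P accB.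
- by move=> N [].
- exists [set 1]; split; first exact: submodule_set1.
    by move=> _ ->; case: subM => [[]].
  exact: dev_interval_trivial.
have MN : M `<=` N.
  move=> m Mm; have N_adj : N `<=` adjoin N m by move=> c Nc X [_]; apply; left.
  suff <- : adjoin N m = N by move=> X [_]; apply; right.
  apply: Nmax; last by rewrite subsetEset.
  split; first exact: adjoin_submodule.
    by apply: smallest_sub => // c [/NM//|->].
  apply: dev_interval_join (dev_ann_layer N b sD Mm) devN => //.
    move=> _ [u [v [Du Nv ->]]]; exists u, v; split=> //.
    exact: ann_orbit_anti Nv.
  move=> _ [u [v [Du Nv ->]]]; exists u, v; split=> //.
  by apply: ann_orbit_anti Nv => _ ->; case: sN => [[]].
rewrite {1}(_ : D = prod_set D (ann_orbit N b)) //.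
apply/seteqP; split.
  by apply: sub_prod_setl; have [[]] := ann_orbit_submodule N b.
apply: prod_set_sub; [by case: sD|by []|].
by apply: subset_trans MbD; exact: ann_orbit_anti.
Qed.

(** A largest [D] with bounded interval above [C] is everything, since adding the
    cyclic module of a further element keeps the interval bounded. *)
Lemma dev_annihilated C : Sub C ->
  (forall r b, scalar r -> kills r M -> C (r b)) -> dev_interval delta C setT.
Proof.
move=> sC MC; pose P := [set D | [/\ Sub D, C `<=` D & dev_interval delta C D]].
have [||D [sD CD devD] Dmax] := @ACC_maximal _ _ Sub P accB.
- by move=> D [].
- by exists C; split=> //; exact: dev_interval_trivial.
suff <- : D = setT by [].
apply/seteqP; split=> // b _; have [[D1 _] _] := sD.
have sP := submodule_prod abB sD (ann_orbit_submodule [set 1] b).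
have o1 : ann_orbit [set 1] b 1 by have [[]] := ann_orbit_submodule [set 1] b.
have DP := sub_prod_setl o1 (H := D).
have <- : prod_set D (ann_orbit [set 1] b) = D.
  apply: Dmax; last by rewrite subsetEset.
  split=> //; first exact: subset_trans DP.
  apply: dev_interval_join devD _ => //; apply: dev_annihilated_orbit => //.
  by move=> _ [r [sr rM ->]]; apply: CD; exact: MC.
by apply: sub_prod_setr => //; exact: mem_orbit.
Qed.

(** Noetherian induction on [C], for the submodules above [C]: as long as some
    scalar killing [M] does not map [B] into [C], its image enlarges [C]
    by [dev_nilpotent], and otherwise [dev_annihilated] applies. *)
Lemma dev_essential : dev_at_most delta Sub.
Proof.
suff : dev_interval delta [set 1] setT.
  apply: dev_at_most_sub => X sX; apply/intervalP; split=> //.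
  by move=> _ ->; case: sX => [[]].
apply: contrapT => ndev.
pose P := [set C | Sub C /\ ~ dev_interval delta C setT].
have [||C [sC nC] Cmax] := @ACC_maximal _ _ Sub P accB.
- by move=> C [].
- by exists [set 1]; split=> //; exact: submodule_set1.
apply: (nC); apply: dev_annihilated => // r b sr rM; apply: contrapT => nCrb.
have [n rn] := killing_nilpotent sr rM.
have sP := submodule_prod abB sC (submodule_range sr).
have CP : C `<=` prod_set C (range r).
  by apply: sub_prod_setl; have [[]] := submodule_range sr.
have [dev'|ndev'] := pselect (dev_interval delta (prod_set C (range r)) setT).
  by apply: nC; exact: dev_nilpotent sr rn sC dev'.
apply: nCrb; rewrite -(Cmax (prod_set C (range r))) ?subsetEset //.
by apply: sub_prod_setr; [case: sC => [[]]|exists b].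
Qed.

End MoreBounded.
End EssentialExtension.

(** * Normal subgroups of split extensions and of groups with a cocycle *)

Section Homomorphisms.
Context {G H : groupType} (p : G -> H) (pM : {morph p : x y / x * y}).

Lemma hom1 : p 1 = 1.
Proof. by apply: (mulgI (p 1)); rewrite -pM !mulg1. Qed.

Lemma homV x : p x^-1 = (p x)^-1.
Proof. by apply/esym/mulg1_eq; rewrite -pM mulgV hom1. Qed.

Lemma homJ x y : p (x ^ y) = p x ^ p y.
Proof. by rewrite !conjgE !pM homV. Qed.

Local Notation normal G := [set N : set G | is_normal_subgroup N].

Lemma normal_preimage N : is_normal_subgroup N -> is_normal_subgroup (p @^-1` N).
Proof.
move=> [sN nN]; split; [split|].
- by rewrite /= hom1; exact: subgroup1.
- by move=> x y Nx Ny; rewrite /= pM homV; exact: subgroupF.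
- by move=> x g Nx; rewrite /= homJ; exact: nN.
Qed.

Lemma normal_image N : range p = setT -> is_normal_subgroup N ->
  is_normal_subgroup (p @` N).
Proof.
move=> pT [sN nN]; split; [split|].
- by exists 1; [exact: subgroup1|exact: hom1].
- move=> _ _ [x Nx <-] [y Ny <-]; exists (x / y); first exact: subgroupF.
  by rewrite pM homV.
- move=> _ h [x Nx <-]; have [g _ <-] : range p h by rewrite pT.
  by exists (x ^ g); [exact: nN|exact: homJ].
Qed.

Lemma dev_quotient {W : wellOrder} (delta : option W) : range p = setT ->
  dev_at_most delta (normal G) -> dev_at_most delta (normal H).
Proof.
move=> pT; apply: (dev_at_most_strict (f := fun N => p @^-1` N)).
- by move=> N; exact: normal_preimage.
- by move=> N N' _ _; rewrite !subsetEset => NN' x; exact: NN'.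
- move=> N N' _ _ _ eNN'; apply/seteqP; split=> h;
    have [g _ <-] : range p h by rewrite pT.
    by move=> Ng; have : (p @^-1` N') g by rewrite -eNN'.
  by move=> Ng; have : (p @^-1` N) g by rewrite eNN'.
Qed.

End Homomorphisms.

Local Notation normal G := [set N : set G | is_normal_subgroup N].

Section SemidirectProduct.
Context {Q B : groupType} (a : automorphic_action Q B).
Hypotheses (abQ : abelian_group Q) (abB : abelian_group B).
Local Notation E := (semidirect a).
Local Notation Sub := (submodules a setT).

Lemma sd_complM : {morph (@sd_compl Q B a) : x y / x * y}.
Proof. by []. Qed.

Lemma range_sd_compl : range (@sd_compl Q B a) = setT.
Proof. by apply/seteqP; split=> // q _; exists (Semidirect a 1 q). Qed.

Lemma sd_mulE b c q r :
  Semidirect a b q * Semidirect a c r = Semidirect a (b * a q c) (q * r).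
Proof. by []. Qed.

Lemma sd_invE b q :
  (Semidirect a b q)^-1 = Semidirect a (a q^-1 b^-1) q^-1.
Proof. by []. Qed.

Lemma sd_conj b c q :
  Semidirect a b 1 ^ Semidirect a c q = Semidirect a (a q^-1 b) 1.
Proof.
rewrite conjgE sd_invE !sd_mulE act_by1 mul1g mulVg.
by rewrite -act_byMr (abelian_mulC abB b) mulKg.
Qed.

Lemma sd_split b q : Semidirect a b q = Semidirect a b 1 * Semidirect a 1 q.
Proof. by rewrite sd_mulE act_by_one mulg1 mul1g. Qed.

Definition normal_part (N : set E) : set B := [set b | N (Semidirect a b 1)].

Lemma normal_part_submodule N : is_normal_subgroup N -> Sub (normal_part N).
Proof.
move=> [sN nN]; split; [split|].
- exact: (subgroup1 sN).
- move=> b c Nb Nc; have := subgroupF sN Nb Nc.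
  by rewrite sd_invE sd_mulE invg1 !act_by1 mulg1.
- move=> q b _ /(nN _ (Semidirect a 1 q^-1)).
  by rewrite sd_conj invgK.
Qed.

(** An element of [N'] and an element of [N] with the same image in [Q] differ by
    an element of the normal part of [N']. *)
Lemma normal_part_strict (N N' : set E) :
  is_normal_subgroup N -> is_normal_subgroup N' -> N `<=` N' ->
  normal_part N = normal_part N' ->
  (@sd_compl Q B a) @` N = (@sd_compl Q B a) @` N' -> N = N'.
Proof.
move=> [sN _] [sN' _] NN' e1 e2; apply/seteqP; split=> // -[b q] N'bq.
have [[c r] Ncq /= rq] : ((@sd_compl Q B a) @` N) q.
  by rewrite e2; exists (Semidirect a b q).
rewrite rq in Ncq.
have : normal_part N (b / c).
  rewrite e1; have := subgroupF sN' N'bq (NN' _ Ncq).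
  by rewrite sd_invE sd_mulE -act_byM mulgV act_by1.
move=> Nbc; have := subgroupM sN Nbc Ncq.
by rewrite sd_mulE act_by1 mulgVK mul1g.
Qed.

Lemma normal_part_compl_strict :
  strict_pair (normal E) Sub (normal Q) normal_part
    (fun N => (@sd_compl Q B a) @` N).
Proof.
split.
- by move=> N; exact: normal_part_submodule.
- by move=> N; apply: normal_image; [exact: sd_complM|exact: range_sd_compl].
- by move=> N N' _ _; rewrite !subsetEset => NN' b; exact: NN'.
- by move=> N N' _ _; rewrite !subsetEset; exact: image_subset.
- by move=> N N' nN nN'; rewrite subsetEset; exact: normal_part_strict.
Qed.

Lemma dev_semidirect {W : wellOrder} (delta : option W) :
  dev_at_most delta Sub -> dev_at_most delta (normal Q) ->
  dev_at_most delta (normal E).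
Proof. exact: dev_at_most_pair normal_part_compl_strict. Qed.

Lemma ACC_semidirect : ACC Sub -> ACC (normal Q) -> ACC (normal E).
Proof. exact: ACC_pair normal_part_compl_strict. Qed.

Lemma dev_submodules {W : wellOrder} (delta : option W) :
  dev_at_most delta (normal E) -> dev_at_most delta Sub.
Proof.
apply: (dev_at_most_strict (f := fun X => (Semidirect a)^~ 1 @` X)).
- move=> X [sX aX]; split; [split|].
  + by exists 1; first exact: subgroup1.
  + move=> _ _ [b Xb <-] [c Xc <-]; exists (b / c); first exact: subgroupF.
    by rewrite sd_invE sd_mulE invg1 !act_by1 mulg1.
  + move=> _ [c r] [b Xb <-]; rewrite sd_conj.
    by exists (a r^-1 b) => //; exact: aX.
- by move=> X Y _ _; rewrite !subsetEset; exact: image_subset.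
- move=> X Y _ _; rewrite subsetEset => XY eXY; apply/seteqP; split=> // b Yb.
  have [c Xc [<- //]] : ((Semidirect a)^~ 1 @` X) (Semidirect a b 1).
  by rewrite eXY; exists b.
Qed.

Lemma semidirect_metabelian : metabelian E.
Proof.
have der x : @derived_subgroup E x -> sd_compl x = 1.
  apply: (@generated_sub E [set x | sd_compl x = 1]).
    split=> // -[b q] [c r] /= -> ->; exact: mulgV.
  move=> _ [[[b q] [c r]] _ <-] /=.
  by apply/eqP; change ([~ q, r] == 1); apply/commgP/abQ.
move=> [b q] [c r] /der /= -> /der /= ->.
by rewrite /commute !sd_mulE !act_by1 (abelian_mulC abB b).
Qed.

Lemma semidirect_fg (s : seq B) : finitely_generated Q ->
  (forall X, Sub X -> [set` s] `<=` X -> X = setT) -> finitely_generated E.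
Proof.
move=> [t tQ] sB.
pose u := [seq Semidirect a b 1 | b <- s] ++ [seq Semidirect a 1 q | q <- t].
exists u; set H := generated _; have sH : is_subgroup H := generated_subgroup _.
have HQ q : H (Semidirect a 1 q).
  suff : generated [set` t] `<=` [set q | H (Semidirect a 1 q)] by apply; rewrite tQ.
  apply: generated_sub => [|r tr].
    split=> [|q' r' Hq Hr]; first exact: (subgroup1 sH).
    have := subgroupF sH Hq Hr.
    by rewrite sd_invE sd_mulE !invg1 !act_by_one mulg1.
  by apply: sub_generated; rewrite /= mem_cat; apply/orP; right; exact: map_f.
have HB : [set b | H (Semidirect a b 1)] = setT.
  apply: sB => [|b sb].
    split; [split|].
    + exact: (subgroup1 sH).
    + move=> b c Hb Hc; have := subgroupF sH Hb Hc.
      by rewrite sd_invE sd_mulE invg1 !act_by1 mulg1.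
    + move=> q b _ Hb.
      have := subgroupM sH (HQ q) (subgroupM sH Hb (subgroupV sH (HQ q))).
      by rewrite sd_invE !sd_mulE invg1 !act_by_one mul1g !mulg1 mul1g mulgV.
  by apply: sub_generated; rewrite /= mem_cat; apply/orP; left; exact: map_f.
apply/seteqP; split=> // -[b q] _; rewrite sd_split; apply: (subgroupM sH _ (HQ q)).
by have : [set b | H (Semidirect a b 1)] b by rewrite HB.
Qed.

End SemidirectProduct.

Section Cocycle.
Context {G Q B : groupType} (p : G -> Q) (a : automorphic_action Q B).
Context (delta : G -> B).
Hypotheses (pM : {morph p : x y / x * y}) (pT : range p = setT).
Hypotheses (abQ : abelian_group Q) (abB : abelian_group B).
Hypothesis deltaM : forall g h, delta (g * h) = delta g * a (p g) (delta h).
Hypothesis delta_inj : forall g, p g = 1 -> delta g = 1 -> g = 1.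
Local Notation E := (semidirect a).
Local Notation Sub := (submodules a setT).

Lemma cocycle1 : delta 1 = 1.
Proof.
by apply: (mulgI (delta 1)); rewrite -{3}(mulg1 1) deltaM (hom1 pM) act_by1 mulg1.
Qed.

Lemma cocycle_kerM g h : p g = 1 -> delta (g * h) = delta g * delta h.
Proof. by move=> pg; rewrite deltaM pg act_by1. Qed.

Lemma cocycle_kerV g : p g = 1 -> delta g^-1 = (delta g)^-1.
Proof.
by move=> pg; apply/esym/mulg1_eq; rewrite -cocycle_kerM // mulgV cocycle1.
Qed.

Lemma cocycle_kerF g h : p g = 1 -> p h = 1 -> delta (g / h) = delta g / delta h.
Proof. by move=> pg ph; rewrite cocycle_kerM // cocycle_kerV. Qed.

(** On the kernel of [p] the cocycle is a [Q]-equivariant homomorphism. *)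
Lemma cocycle_conj m g : p m = 1 -> delta (m ^ g) = a (p g)^-1 (delta m).
Proof.
move=> pm; rewrite conjgE deltaM cocycle_kerM // (homV pM) act_byMr.
rewrite (abelian_mulC abB (a _ (delta m))) mulgA -(homV pM) -deltaM.
by rewrite mulVg cocycle1 mul1g.
Qed.

Lemma cocycle_ker_inj g h : p g = 1 -> p h = 1 -> delta g = delta h -> g = h.
Proof.
move=> pg ph dgh; apply/divg1_eq/delta_inj.
  by rewrite pM (homV pM) pg ph mulgV.
by rewrite cocycle_kerF // dgh mulgV.
Qed.

Definition ker_image (N : set G) : set B :=
  [set b | exists m, [/\ N m, p m = 1 & delta m = b]].

Lemma ker_image_submodule N : is_normal_subgroup N -> Sub (ker_image N).
Proof.
move=> [sN nN]; split; [split|].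
- exists 1; split; [exact: subgroup1|exact: hom1|exact: cocycle1].
- move=> _ _ [m [Nm pm <-]] [n [Nn pn <-]]; exists (m / n).
  split; first exact: subgroupF.
    by rewrite pM (homV pM) pm pn mulgV.
  by rewrite cocycle_kerF.
- move=> q _ _ [m [Nm pm <-]]; have [g _ pg] : range p q^-1 by rewrite pT.
  exists (m ^ g); split; first exact: nN.
    by rewrite (homJ pM) pm conj1g.
  by rewrite cocycle_conj // pg invgK.
Qed.

Lemma normalT : is_normal_subgroup [set: G].
Proof. by []. Qed.

(** A normal subgroup of [G] is determined, among those above it, by its parts in
    the kernel of [p] and in [Q]; the former is a submodule of [B] through
    [delta]. *)
Lemma dev_group {W : wellOrder} (delta' : option W) :
  dev_at_most delta' Sub -> dev_at_most delta' (normal Q) -> dev_at_most delta' (normal G).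
Proof.
apply: (dev_at_most_pair (f1 := ker_image) (f2 := fun N => p @` N)); split.
- by move=> N; exact: ker_image_submodule.
- by move=> N; exact: normal_image.
- move=> N N' _ _; rewrite !subsetEset => NN' b [m [Nm pm dm]].
  by exists m; split=> //; exact: NN'.
- by move=> N N' _ _; rewrite !subsetEset; exact: image_subset.
- move=> N N' [sN _] [sN' _]; rewrite subsetEset => NN' e1 e2.
  apply/seteqP; split=> // x N'x.
  have [y Ny pyx] : (p @` N) (p x) by rewrite e2; exists x.
  have pxy : p (x / y) = 1 by rewrite pM (homV pM) pyx mulgV.
  have [m [Nm pm dm]] : ker_image N (delta (x / y)).
    rewrite e1; exists (x / y); split=> //; apply: subgroupF => //.
    exact: NN'.
  rewrite -(mulgVK y x); apply: subgroupM => //.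
  by rewrite -(cocycle_ker_inj pm pxy dm).
Qed.

(** Through [delta], the submodules of [delta (ker p)] correspond to the normal
    subgroups of [G] inside [ker p]. *)
Lemma dev_ker_image {W : wellOrder} (delta' : option W) :
  dev_at_most delta' (normal G) ->
  dev_at_most delta' (submodules_in a setT (ker_image setT)).
Proof.
apply: (dev_at_most_strict (f := fun X : set B => [set g | p g = 1 /\ X (delta g)])).
- move=> X [[sX aX] XM]; split; [split|].
  + by split; [exact: hom1|rewrite cocycle1; exact: subgroup1].
  + move=> g h [pg Xg] [ph Xh]; split; first by rewrite pM (homV pM) pg ph mulgV.
    by rewrite cocycle_kerF //; exact: subgroupF.
  + move=> m g [pm Xm]; split; first by rewrite (homJ pM) pm conj1g.
    by rewrite cocycle_conj //; exact: aX.
- by move=> X Y _ _; rewrite !subsetEset => XY g [pg /XY].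
- move=> X Y [_ XM] [_ YM]; rewrite subsetEset => XY eXY.
  apply/seteqP; split=> // b Yb; have [m [_ pm dm]] := YM b Yb.
  have [_] : [set g | p g = 1 /\ X (delta g)] m by rewrite eXY /= dm.
  by rewrite dm.
Qed.

Lemma ACC_normal_fg_abelian : finitely_generated Q -> ACC (normal Q).
Proof.
move=> [s sQ]; have [N [sN Ns] accN] := ACC_fg abQ s.
move=> X nX; apply: accN => i; split; first by case: (nX i).
by move=> x _; apply: (generated_sub sN Ns); rewrite sQ.
Qed.

(** Bounds on [G] and on the split extension are both equivalent to bounds on the
    submodules of [B] and the subgroups of [Q]; essentiality is what passes a
    bound from the part of [B] coming from [G] to all of [B]. *)
Lemma same_Krull_dimension : finitely_generated Q -> ACC Sub ->
  (forall X, Sub X -> X `&` ker_image setT `<=` [set 1] -> X `<=` [set 1]) ->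
  exists (W : wellOrder) (delta' : option W),
    has_Krull_dimension G delta' /\ has_Krull_dimension E delta'.
Proof.
move=> Qfg accB essM.
have accE : ACC (normal E).
  exact: ACC_semidirect abB accB (ACC_normal_fg_abelian Qfg).
have normal1 : normal E [set 1].
  by split=> [|x g -> /=]; [exact: subgroup_set1|rewrite conj1g].
have [W [n devE]] : exists (W : wellOrder) (n : W), dev_le n (normal E).
  apply: ACC_dev_le accE normal1 _ => N [sN _]; rewrite subsetEset => _ ->.
  exact: subgroup1.
exists W.
suff same (delta' : option W) : dev_at_most delta' (normal E) <-> dev_at_most delta' (normal G).
  by have [delta' [dE dG]] := same_deviation same devE; exists delta'; split.
split=> devX.
  apply: dev_group; first exact: dev_submodules devX.
  apply: (dev_quotient (@sd_complM _ _ a)) devX; exact: range_sd_compl.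
apply: dev_semidirect => //; last exact: dev_quotient devX.
apply: (dev_essential abQ abB accB _ essM); last exact: dev_ker_image.
exact: ker_image_submodule normalT.
Qed.

End Cocycle.

(** * Subquotients of modules *)

Section Subquotient.
Context {Q C : groupType} (a : automorphic_action Q C).
Hypothesis abC : abelian_group C.
Variables (P K : set C).
Local Notation Sub := (submodules a setT).
Hypotheses (subP : Sub P) (subK : Sub K).

Let sP := subP.1.
Let sK := subK.1.

Definition coset (x : C) : set C := [set y | P y /\ K (x / y)].

(** A choice of one representative in each coset of [K] in [P]. *)
Definition coset_repr (x : C) : C := xget 1 (coset x).

Lemma coset_reprP x : P x -> coset x (coset_repr x).
Proof.
move=> Px; apply: (@xgetI _ 1 _ x); split=> //.
by rewrite mulgV; exact: subgroup1.
Qed.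

Lemma coset_repr_in x : P (coset_repr x).
Proof.
by rewrite /coset_repr; case: xgetP => [y _ []//|_]; exact: subgroup1.
Qed.

Lemma coset_repr_eq x y : P x -> P y -> (coset_repr x = coset_repr y) <-> K (x / y).
Proof.
move=> Px Py; split=> [e|Kxy].
  have [_ Kx] := coset_reprP Px; have [_ Ky] := coset_reprP Py.
  have := subgroupF sK Kx Ky.
  by rewrite e mulgKA.
congr xget; apply/seteqP; split=> z [Pz Kz]; split=> //.
  rewrite -(mulKg (x / y) (y / z)); apply: subgroupM => //; first exact: subgroupV.
  by rewrite mulgA mulgVK.
by rewrite -(mulgVK y x) -mulgA; exact: subgroupM.
Qed.

Lemma coset_repr_id x : P x -> coset_repr (coset_repr x) = coset_repr x.
Proof.
move=> Px; apply/esym/coset_repr_eq => //; first exact: coset_repr_in.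
by case: (coset_reprP Px).
Qed.

(** The group [P / K] is realised on the set of chosen representatives, which
    forms the subgroup [P] and its quotient in a single subtype. *)
Lemma subquotient :
  exists (B : groupType) (b : automorphic_action Q B) (pr : C -> B),
  [/\ abelian_group B,
      forall x y, P x -> P y -> pr (x * y) = pr x * pr y,
      forall x, P x -> (pr x = 1) <-> K x,
      forall u, exists2 x, P x & pr x = u &
      forall q x, P x -> pr (a q x) = b q (pr x)].
Proof.
pose is_repr : pred C := fun x => `[< P x /\ coset_repr x = x >].
pose T := {x : C | is_repr x}.
have PT (u : T) : P (val u) by case: u => x /= /asboolP[].
have P1 : P 1 by exact: subgroup1.
have PM x y : P x -> P y -> P (x * y) by exact: subgroupM.
have PV x : P x -> P x^-1 by exact: subgroupV.
have Pa q x : P x -> P (a q x) by move=> Px; case: subP => _; apply.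
have Prepr1 : is_repr (coset_repr 1).
  by apply/asboolP; split; [exact: coset_repr_in|exact: coset_repr_id].
pose pr x : T := insubd (exist is_repr _ Prepr1) (coset_repr x).
have prE x : P x -> val (pr x) = coset_repr x.
  move=> Px; rewrite insubdK //; apply/asboolP; split; first exact: coset_repr_in.
  exact: coset_repr_id.
have prK (u : T) : pr (val u) = u.
  apply/val_inj; rewrite prE //.
  by case: u => x /= /asboolP[].
have pr_eq x y : P x -> P y -> (pr x = pr y) <-> K (x / y).
  move=> Px Py; rewrite -coset_repr_eq //; split=> [e|e].
    by rewrite -!prE // e.
  by apply/val_inj; rewrite !prE.
have pr_surj (u : T) : exists2 x, P x & pr x = u by exists (val u).
have pr_val x : P x -> K (val (pr x) / x).
  by move=> Px; apply/pr_eq => //; rewrite prK.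
pose mul (u v : T) : T := pr (val u * val v).
pose inv (u : T) : T := pr (val u)^-1.
have mulE x y : P x -> P y -> mul (pr x) (pr y) = pr (x * y).
  move=> Px Py; apply/pr_eq; [exact: PM|exact: PM|].
  by rewrite abelian_divM //; apply: subgroupM => //; exact: pr_val.
have invE x : P x -> inv (pr x) = pr x^-1.
  move=> Px; apply/pr_eq; [exact: PV|exact: PV|].
  by rewrite invgK abelian_mulC // -invgF; apply: subgroupV => //; exact: pr_val.
have mA : associative mul.
  move=> u v w; have [x Px <-] := pr_surj u; have [y Py <-] := pr_surj v.
  have [z Pz <-] := pr_surj w.
  by rewrite !mulE ?mulgA //; exact: PM.
have m1 : left_id (pr 1) mul.
  by move=> u; have [x Px <-] := pr_surj u; rewrite mulE // mul1g.
have m1r : right_id (pr 1) mul.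
  by move=> u; have [x Px <-] := pr_surj u; rewrite mulE // mulg1.
have mV : left_inverse (pr 1) inv mul.
  move=> u; have [x Px <-] := pr_surj u.
  by rewrite invE // mulE ?mulVg //; exact: PV.
have mVr : right_inverse (pr 1) inv mul.
  move=> u; have [x Px <-] := pr_surj u.
  by rewrite invE // mulE ?mulgV //; exact: PV.
pose B : groupType := HB.pack T (isGroup.Build T mA m1 m1r mV mVr).
pose act q (u : B) : B := pr (a q (val u)).
have actE q x : P x -> act q (pr x) = pr (a q x).
  move=> Px; apply/pr_eq; [exact: Pa|exact: Pa|].
  by rewrite -act_byF; case: subK => _; apply=> //; exact: pr_val.
have act1 u : act 1 u = u by rewrite /act act_by1 prK.
have actM q r u : act (q * r) u = act q (act r u).
  have [x Px <-] := pr_surj u.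
  by rewrite !actE ?act_byM //; exact: Pa.
have actMr q (u v : B) : act q (u * v) = act q u * act q v.
  have [x Px <-] := pr_surj u; have [y Py <-] := pr_surj v.
  rewrite [X in act q X](mulE x y) // !actE //; last exact: PM.
  by rewrite act_byMr; apply/esym/mulE; exact: Pa.
exists B, (AutomorphicAction act1 actM actMr), pr; split=> //.
- move=> u v _ _; have [x Px <-] := pr_surj u; have [y Py <-] := pr_surj v.
  by rewrite /commute [LHS]mulE // [RHS]mulE // abelian_mulC.
- by move=> x y Px Py; rewrite [RHS]mulE.
- by move=> x Px; rewrite -[X in K X]divg1; exact: pr_eq.
- by move=> q x Px; rewrite /= actE.
Qed.

End Subquotient.

(** * The cocycle of an extension and its essential quotient *)

(** The module coinduced from the trivial subgroup of [Q]; a separate name keeps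
    its group structure off general function types. *)
Definition coinduced (Q M : groupType) := Q -> M.

Section Coinduced.
Context {Q M : groupType}.
Local Notation C := (coinduced Q M).

HB.instance Definition _ := gen_eqMixin C.
HB.instance Definition _ := gen_choiceMixin C.

Definition coinduced_one : C := fun=> 1.
Definition coinduced_inv (f : C) : C := fun x => (f x)^-1.
Definition coinduced_mul (f g : C) : C := fun x => f x * g x.

Lemma coinduced_mulA : associative coinduced_mul.
Proof. by move=> f g h; apply/funext => x; exact: mulgA. Qed.

Lemma coinduced_mul1g : left_id coinduced_one coinduced_mul.
Proof. by move=> f; apply/funext => x; exact: mul1g. Qed.

Lemma coinduced_mulg1 : right_id coinduced_one coinduced_mul.
Proof. by move=> f; apply/funext => x; exact: mulg1. Qed.

Lemma coinduced_mulVg : left_inverse coinduced_one coinduced_inv coinduced_mul.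
Proof. by move=> f; apply/funext => x; exact: mulVg. Qed.

Lemma coinduced_mulgV : right_inverse coinduced_one coinduced_inv coinduced_mul.
Proof. by move=> f; apply/funext => x; exact: mulgV. Qed.

HB.instance Definition _ := isGroup.Build C coinduced_mulA coinduced_mul1g
  coinduced_mulg1 coinduced_mulVg coinduced_mulgV.

Definition translate (q : Q) (f : C) : C := fun x => f (x * q).

Lemma translate1 f : translate 1 f = f.
Proof. by apply/funext => x; rewrite /translate mulg1. Qed.

Lemma translateM q r f : translate (q * r) f = translate q (translate r f).
Proof. by apply/funext => x; rewrite /translate mulgA. Qed.

Lemma translateMr q f g : translate q (f * g) = translate q f * translate q g.
Proof. by []. Qed.

Definition translation : automorphic_action Q C :=
  AutomorphicAction translate1 translateM translateMr.

Lemma coinduced_abelian : abelian_group M -> abelian_group C.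
Proof. by move=> abM f g _ _; apply/funext => x; exact: abM. Qed.

End Coinduced.

Section CoinducedCocycle.
Context {G M Q : groupType} (i : {multiplicative M -> G}).
Context (p : {multiplicative G -> Q}).
Hypothesis (ex : short_exact i p).

(** The Kaloujnine-Krasner embedding: [s x * g] and [s (x * p g)] lie over the same
    element of [Q], and [delta g x] is their quotient in [M]. *)
Lemma coinduced_cocycle :
  exists2 delta : G -> coinduced Q M,
    forall g h, delta (g * h) = delta g * translation (p g) (delta h) &
    forall g, p g = 1 -> delta g = 1 -> g = 1.
Proof.
have [inj_i im_i im_p] := ex.
have pM := @gmulfM _ _ p; have iM := @gmulfM _ _ i.
have /choice[s sP] x : exists g, p g = x.
  have [g _ pg] : range p x by rewrite im_p.
  by exists g.
have ker g : exists m, p g = 1 -> i m = g.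
  have [pg|npg] := pselect (p g = 1); last by exists 1.
  have [m _ im] : range i g by rewrite im_i.
  by exists m.
have [j jP] := choice ker.
pose d g x := s x * g / s (x * p g).
have pd g x : p (d g x) = 1 by rewrite /d !pM (homV pM) !sP mulgV.
pose delta g : coinduced Q M := fun x => j (d g x).
exists delta.
- move=> g h; apply/funext => x; apply: inj_i.
  rewrite [RHS](iM (delta g x) (delta h (x * p g))) !jP //.
  by rewrite /d pM !mulgA mulgVK.
- move=> g pg d1; have : i (delta g 1) = 1 by rewrite d1 (hom1 iM).
  rewrite jP // /d pg mulg1 => e; apply: (mulgI (s 1)).
  by rewrite mulg1; exact: divg1_eq e.
Qed.

End CoinducedCocycle.

Section Embedding.
Context {G Q C : groupType} (p : G -> Q) (a : automorphic_action Q C).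
Context (delta : G -> C).
Hypothesis pM : {morph p : x y / x * y}.
Hypotheses (abQ : abelian_group Q) (abC : abelian_group C).
Hypotheses (Gfg : finitely_generated G) (Qfg : finitely_generated Q).
Hypothesis deltaM : forall g h, delta (g * h) = delta g * a (p g) (delta h).
Hypothesis delta_inj : forall g, p g = 1 -> delta g = 1 -> g = 1.

(** The coinduced module is cut down to the submodule [P] generated by the cocycle
    values on generators of [G], then divided by a submodule [K] of [P] maximal
    subject to meeting the image of [ker p] trivially.  A submodule of [P / K]
    that meets the image of [ker p] trivially pulls back to a submodule of [P]
    with the same property as [K], hence to [K]. *)
Lemma essential_cocycle :
  exists (B : groupType) (b : automorphic_action Q B) (eps : G -> B),
  [/\ abelian_group B,
      forall g h, eps (g * h) = eps g * b (p g) (eps h),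
      forall g, p g = 1 -> eps g = 1 -> g = 1,
      ACC (submodules b setT) &
      exists2 s : seq B,
        forall X, submodules b setT X -> [set` s] `<=` X -> X = setT &
        forall X, submodules b setT X ->
          X `&` ker_image p eps setT `<=` [set 1] -> X `<=` [set 1]].
Proof.
have [s sG] := Gfg.
have [N [subN sN] accN] := ACC_fg_module a abQ abC (map delta s) Qfg.
pose P := smallest (submodules a setT) [set` map delta s].
have subP : submodules a setT P.
  split; [split|].
  - by move=> X [[[]]].
  - move=> x y Px Py X XP; case: (XP) => -[sX _] _.
    exact: subgroupF (Px X XP) (Py X XP).
  - by move=> q x _ Px X XP; case: (XP) => -[_ aX] _; exact: aX (Px X XP).
have sP := subP.1.
have PN : P `<=` N by apply: smallest_sub.
have accP : ACC (submodules_in a setT P).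
  move=> X XP; apply: accN => k; have [sX XkP] := XP k; split=> //.
  exact: subset_trans PN.
have deltaP g : P (delta g).
  suff : generated [set` s] `<=` [set g | P (delta g)] by apply; rewrite sG.
  apply: generated_sub => [|h sh].
    have dV h : P (delta h) -> P (delta h^-1).
      have := deltaM h^-1 h; rewrite mulVg (cocycle1 pM deltaM) => /esym/mulg1_eq e.
      move=> Ph; rewrite -[delta h^-1]invgK e; apply: (subgroupV sP).
      by case: subP => _; apply.
    split=> [|g' h Pg Ph] /=.
      by rewrite (cocycle1 pM deltaM); exact: subgroup1.
    rewrite deltaM; apply: (subgroupM sP) => //; case: subP => _; apply=> //.
    exact: dV.
  by move=> X [_]; apply; exact: map_f.
pose MG := ker_image p delta setT.
(* Candidates for the kernel [K] of the projection to [B]. *)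
pose F := [set X | submodules_in a setT P X /\ X `&` MG `<=` [set 1]].
have [||K [[subK KP] KM] Kmax] := @ACC_maximal _ _ _ F accP.
- by move=> X [].
- exists [set 1]; split; last by move=> x [].
  split; first exact: submodule_set1.
  by move=> _ ->; exact: subgroup1.
have [B [b [pr [abB prM pr1 pr_surj pr_act]]]] := subquotient abC subP subK.
have prP1 : pr 1 = 1 by apply/pr1; [exact: subgroup1|exact: (subgroup1 subK.1)].
have prV x : P x -> pr x^-1 = (pr x)^-1.
  move=> Px; apply/esym/mulg1_eq; rewrite -prM ?mulgV //.
  exact: (subgroupV sP).
pose lift (X : set B) : set C := [set x | P x /\ X (pr x)].
have lift_sub X : submodules b setT X -> submodules_in a setT P (lift X).
  move=> [sX aX]; split; last by move=> x [].
  split; [split|].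
  - by split; [exact: subgroup1|rewrite prP1; exact: subgroup1].
  - move=> x y [Px Xx] [Py Xy]; split; first exact: (subgroupF sP).
    rewrite prM ?prV //; first exact: subgroupF.
    exact: (subgroupV sP).
  - move=> q x _ [Px Xx]; split; first by case: subP => _; apply.
    by rewrite pr_act //; exact: aX.
have lift_mono X Y : X `<=` Y -> lift X `<=` lift Y by move=> XY x [Px /XY].
exists B, b, (pr \o delta); split=> //.
- by move=> g h /=; rewrite deltaM prM ?pr_act //; case: subP => _; apply.
- move=> g pg /= /(pr1 _ (deltaP g)) Kg; apply: delta_inj => //.
  by apply: KM; split=> //; exists g.
- apply: (@ACC_pair _ _ _ _ _ _ _ _ _ lift lift) (accP) (accP); split=> //.
  + by move=> X Y _ _; rewrite !subsetEset; exact: lift_mono.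
  + by move=> X Y _ _; rewrite !subsetEset; exact: lift_mono.
  + move=> X Y _ _ _ eXY _; apply/seteqP; split=> u; have [x Px <-] := pr_surj u.
      by move=> Xx; have [] : lift Y x by rewrite -eXY.
    by move=> Yx; have [] : lift X x by rewrite eXY.
- exists (map (pr \o delta) s).
    move=> X sX sub; apply/seteqP; split=> // u _; have [x Px <-] := pr_surj u.
    have [] : lift X x; last by [].
    apply: Px; split; first by case: (lift_sub X sX).
    move=> _ /mapP[g gs ->]; split; first exact: deltaP.
    by apply: sub; apply/mapP; exists g.
  move=> X sX XM u Xu; have [x Px xu] := pr_surj u.
  have KX : K `<=` lift X.
    move=> k Kk; split; first exact: KP.
    by rewrite (pr1 k (KP k Kk)).2 //; exact: (subgroup1 sX.1).
  have liftE : lift X = K.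
    apply: Kmax; last by rewrite subsetEset.
    split; first exact: lift_sub.
    move=> y [[Py Xy] [m [_ pm dm]]].
    have Ky : K y by apply/pr1 => //; apply: XM; split=> //; exists m; rewrite /= dm.
    by apply: KM; split=> //; exists m.
  rewrite -xu; apply/pr1 => //.
  by rewrite -liftE; split=> //; rewrite xu.
Qed.

End Embedding.

Theorem theorem4 (G M Q : groupType)
  (i : {multiplicative M -> G}) (p : {multiplicative G -> Q})
  (G_fg : finitely_generated G) (G_metabelian : metabelian G)
  (M_abelian : abelian_group M)
  (Q_fg : finitely_generated Q) (Q_abelian : abelian_group Q)
  (ex_MGQ : short_exact i p) :
  exists (B : groupType) (a : automorphic_action Q B),
    abelian_group B /\
    finitely_generated (semidirect a) /\
    metabelian (semidirect a) /\
    (exists f : {multiplicative G -> semidirect a}, injective f) /\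
    (exists (W : wellOrder) (delta : option W),
       has_Krull_dimension G delta /\
       has_Krull_dimension (semidirect a) delta).
Proof.
have [_ _ pT] := ex_MGQ; have pM := @gmulfM _ _ p.
have [delta deltaM delta_inj] := coinduced_cocycle ex_MGQ.
have abC := @coinduced_abelian Q M M_abelian.
have [B [b [eps [abB epsM eps_inj accB [s sB essB]]]]] :=
  essential_cocycle pM Q_abelian abC G_fg Q_fg deltaM delta_inj.
exists B, b; split=> //; split; first exact: semidirect_fg Q_fg sB.
split; first exact: semidirect_metabelian.
split; last exact: same_Krull_dimension Q_abelian abB epsM eps_inj Q_fg accB essB.
pose f g := Semidirect b (eps g) (p g).
have fM : {morph f : x y / x * y} by move=> g h; rewrite /f epsM pM.
exists (HB.pack_for {multiplicative G -> semidirect b} f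
  (isMultiplicative.Build G (semidirect b) f fM)).
move=> g h /= [egh pgh].
apply/divg1_eq/eps_inj; first by rewrite pM (homV pM) pgh mulgV.
have := fM (g / h) h; rewrite mulgVK /f pM (homV pM) pgh mulgV egh.
move=> [+ _]; rewrite act_by1 => e.
by apply: (mulIg (eps h)); rewrite mul1g -e.
Qed.
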